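(* Let $\hat\xi=\Delta^{G_2}_{\xi_1\xi_2\ldots\xi_n\ldots}$ be a continuous random variable whose digits $(\xi_n)_{n\ge1}$ are independent and identically distributed, i.e. $P\{\xi_n=i\}=p_i$ for $i=0,1$ and all $n$ (with $p_0+p_1=1$). Then the distribution of $\hat\xi$ is singularly continuous, and the essential support of this distribution is the fractal set of Besicovitch--Eggleston type $$B[G_2;p_0]=\{x\in[0,g_0] : \nu_0(x)=p_0\},$$ whose Hausdorff--Besicovitch dimension is $$\alpha_0(B[G_2;p_0])=\frac{\ln\left(p_0^{p_0}p_1^{p_1}\right)}{\ln\left(g_0^{p_0}(-g_1)^{p_1}\right)}.$$
   Context: Fix a real number $g_0\in[\frac12,1)$ and put $g_1=g_0-1$, $\delta_0=0$, $\delta_1=g_0$. For a sequence $(\alpha_n)_{n\ge1}$ of elements of $\{0,1\}$ put $$\Delta^{G_2}_{\alpha_1\alpha_2\ldots\alpha_n\ldots}=\delta_{\alpha_1}+\sum_{k=2}^\infty \delta_{\alpha_k}\prod_{j=1}^{k-1}g_{\alpha_j}\in[0,g_0].$$ Every $x\in[0,g_0]$ equals $\Delta^{G_2}_{\alpha_1\alpha_2\ldots}$ for some sequence of zeros and ones (a $G_2$-representation of $x$, with digits $\alpha_n$). The representation is unique except for countably many numbers having exactly two representations $\Delta^{G_2}_{\alpha_1\ldots\alpha_{m-1}01(0)}=\Delta^{G_2}_{\alpha_1\ldots\alpha_{m-1}11(0)}$, where $(0)$ denotes the period $000\ldots$. The random variables $\xi_n$ take the values $0$ and $1$. The random variable $\hat\xi$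 is continuous if its distribution has no atoms, i.e. $P\{\hat\xi=x\}=0$ for every $x$. For $x=\Delta^{G_2}_{\alpha_1\alpha_2\ldots}$ put $N_1(x,k)=\alpha_1+\cdots+\alpha_k$ and $N_0(x,k)=k-N_1(x,k)$; the frequency of the digit $i$ in $x$ is $\nu_i(x)=\lim_{k\to\infty}N_i(x,k)/k$, if the limit exists (for numbers with two representations the value does not depend on the choice of representation). The condition $\nu_0(x)=p_0$ means that the limit exists and equals $p_0$. A distribution is singularly continuous if it has no atoms and is concentrated on a set of zero Lebesgue measure. An essential support of the distribution is understood as a Borel set of full probability with respect to the distribution (that is, $P\{\hat\xi\in B\}=1$). A set is called fractal if it is structurally or metrically fractal, that is, a scale-invariant set, a set of fractional Hausdorff--Besicovitch dimension, or an anomalously fractal or superfractal set.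
   Formalization: Singular continuity is claimed only for p_0 ≠ g_0: if p_0 = g_0 the distribution is uniform on [0, g_0], hence absolutely continuous (e.g. g_0 = p_0 = 1/2). The claims on essential support, fractality and dimension are kept in all cases. *)

(* Defs.v *)
From HB Require Import structures.
From mathcomp Require Import all_boot all_order all_algebra.
From mathcomp Require Import all_classical all_reals all_analysis.
Set Implicit Arguments.
Unset Strict Implicit.
Unset Printing Implicit Defensive.
Import Order.TTheory GRing.Theory Num.Theory.
Import numFieldNormedType.Exports.
Local Open Scope classical_set_scope.
Local Open Scope ring_scope.

(** * The G2-representation

    Digits are booleans ([false] is 0, [true] is 1) and digit sequences are
    indexed from 0, so [alpha n] is the digit usually written alpha_(n+1). *)

Definition G2_g {R : realType} (g0 : R) (i : bool) : R :=
  if i then g0 - 1 else g0.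

Definition G2_delta {R : realType} (g0 : R) (i : bool) : R :=
  if i then g0 else 0.

(** The term of index 0 has an empty product, i.e. it is [delta (alpha 0)]. *)
Definition G2_value {R : realType} (g0 : R) (alpha : nat -> bool) : R :=
  limn (series (fun k : nat =>
    G2_delta g0 (alpha k) * \prod_(j < k) G2_g g0 (alpha j))).

Definition digit_count (alpha : nat -> bool) (i : bool) (k : nat) : nat :=
  let N1 := (\sum_(j < k) alpha j)%N in if i then N1 else (k - N1)%N.

(** [G2_frequency g0 i x l]: the frequency of the digit [i] in [x] exists and
    equals [l].  Two representations of the same number have the same tail
    from some place on, so quantifying existentially over them is harmless. *)
Definition G2_frequency {R : realType} (g0 : R) (i : bool) (x l : R) : Prop :=
  exists2 alpha : nat -> bool, x = G2_value g0 alpha &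
    (fun k : nat => (digit_count alpha i k)%:R / k%:R : R) @ \oo --> l.

Definition besicovitch_eggleston {R : realType} (g0 p0 : R) : set R :=
  [set x | 0 <= x <= g0 /\ G2_frequency g0 false x p0].

(** * Probability *)

Definition mutually_independent {R : realType} {d d' : measure_display}
    {Omega : measurableType d} {T : measurableType d'} (P : probability Omega R)
    (X : nat -> {RV P >-> T}) : Prop :=
  forall (s : seq nat) (B : nat -> set T), uniq s ->
    (forall n, measurable (B n)) ->
    P (\bigcap_(n in [set` s]) (X n @^-1` B n)) =
    (\prod_(n <- s) P (X n @^-1` B n))%E.

Definition no_atoms {R : realType}
    (mu : probability R R) : Prop :=
  forall x : R, mu [set x] = 0%E.

Definition singularly_continuous {R : realType}
    (mu : probability R R) : Prop :=
  no_atoms mu /\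
  exists N : set R,
    [/\ measurable N, lebesgue_measure N = 0%E & mu N = 1%E].

Definition essential_support {R : realType}
    (mu : probability R R)
    (B : set R) : Prop :=
  measurable B /\ mu B = 1%E.

(** * Hausdorff-Besicovitch dimension of subsets of the line *)

(** [diam set0] is [-oo]. *)
Definition diam {R : realType} (U : set R) : \bar R :=
  ereal_sup [set `|x - y|%:E | x in U & y in U].

(** Empty sets cost nothing, also for [s = 0], where [0 `^ 0 = 1]. *)
Definition hausdorff_cost {R : realType} (s : R) (U : set R) : \bar R :=
  if U == set0 then 0%E else poweR (diam U) s.

(** Covers are sequences of arbitrary sets, possibly empty from some index on,
    so that finite covers are included. *)
Definition hausdorff_premeasure {R : realType} (s e : R) (E : set R) : \bar R :=
  ereal_inf [set (\sum_(0 <= n <oo) hausdorff_cost s (U n))%E |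
    U in [set U : nat -> set R |
      E `<=` \bigcup_n U n /\ forall n, (diam (U n) <= e%:E)%E]].

(** The premeasure is nonincreasing in [e], so the supremum is the limit as
    [e] tends to 0. *)
Definition hausdorff_measure {R : realType} (s : R) (E : set R) : \bar R :=
  ereal_sup [set hausdorff_premeasure s e E | e in [set e : R | 0 < e]].

Definition hausdorff_dim {R : realType} (E : set R) : \bar R :=
  ereal_inf [set s%:E | s in [set s : R | 0 <= s /\ hausdorff_measure s E = 0%E]].

(** * Fractal sets of the line *)

(** A nonempty bounded set which is a union of at least two smaller similar
    copies of itself; the copies may overlap only in sets of smaller dimension,
    which excludes e.g. singletons.  Similarities of the line are the maps
    [x |-> k * x + a] with [k != 0]. *)
Definition scale_invariant {R : realType} (E : set R) : Prop :=
  [/\ E !=set0, bounded_set E &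
    exists (n : nat) (k a : 'I_n -> R),
      let copy i := [set k i * x + a i | x in E] in
      [/\ (2 <= n)%N,
          forall i, 0 < `|k i| < 1,
          E = \bigcup_(i in [set: 'I_n]) copy i &
          forall i j, i != j ->
            (hausdorff_dim (copy i `&` copy j) < hausdorff_dim E)%E]].

Definition fractional_dim {R : realType} (E : set R) : Prop :=
  forall n : nat, hausdorff_dim E <> n%:R%:E.

(** A set of the cardinality of the continuum and of dimension 0. *)
Definition anomalously_fractal {R : realType} (E : set R) : Prop :=
  (E #= [set: R])%card /\ hausdorff_dim E = 0%E.

(** A Lebesgue-null set of full dimension. *)
Definition superfractal {R : realType} (E : set R) : Prop :=
  (@lebesgue_measure R).-negligible E /\ hausdorff_dim E = 1%E.

Definition fractal {R : realType} (E : set R) : Prop :=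
  [\/ scale_invariant E, fractional_dim E, anomalously_fractal E
    | superfractal E].

(* Main.v *)
Require Import Defs.
From HB Require Import structures.
From mathcomp Require Import all_boot all_order all_algebra.
From mathcomp Require Import all_classical all_reals all_analysis.
From mathcomp Require Import measurable_realfun.
From mathcomp Require Import ring lra.
Set Implicit Arguments.
Unset Strict Implicit.
Unset Printing Implicit Defensive.
Import Order.TTheory GRing.Theory Num.Theory.
Import numFieldNormedType.Exports.
Local Open Scope classical_set_scope.
Local Open Scope ring_scope.

(** The two affine branches [G2_branch] map [0, g0] onto two intervals that
    share only the point [g0 ^+ 2], with ratios [g0] and [1 - g0].  Their
    iterates along words give the cylinders, and outside of the countable set of
    common endpoints of cylinders a number determines its digits
    ([cylinder_prefix]).  As the distribution has no atoms, this countable set is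
    negligible and both digits have positive probability; the cylinder of a word
    [w] thus has mass the product of the digit probabilities along [w] and
    length [g0] times the product of the ratios along [w].

    The strong law of large numbers ([strong_law_digits]), obtained from a
    Chernoff bound and the Borel-Cantelli lemma, says that almost surely the
    digit 0 has frequency [p0]; this is the essential support.

    Let h be the entropy [- (p0 ln p0 + p1 ln p1)] and lambda the rate
    [- (p0 ln g0 + p1 ln (1 - g0))].  Along a sequence with frequency [p0] the
    cylinders of level n have mass about exp (- n h) and length about
    exp (- n lambda) ([cvg_cylinder_exponent]).  For s > h / lambda the s-th
    power of the length is exponentially smaller than the mass; since the masses
    at each level sum up to 1, the cylinders of the long words with this
    property form covers of arbitrarily small cost ([hausdorff_measure_upper]).
    For s < h / lambda the mass is eventually at most the s-th power of the
    length, and the mass distribution principle applies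
    ([hausdorff_measure_lower]).  An arbitrary
    covering set is dealt with by [two_cylinders]: an interval is contained in
    the union of two cylinders of comparable size.  The dimension is therefore
    h / lambda.

    By Gibbs' inequality h < lambda unless [p0 = g0], so that the
    one-dimensional Hausdorff measure, hence the Lebesgue measure, of the set
    vanishes.  Finally the set is the union of its images under the two
    branches, which meet in at most one point, so that it is scale-invariant:
    this covers the case [p0 = g0] as well, where the dimension is 1. *)

(** * Cylinders of the G2-representation *)

(** The affine map that puts the digit [i] in front of a representation. *)
Definition G2_branch {R : realType} (g0 : R) (i : bool) (x : R) : R :=
  G2_delta g0 i + G2_g g0 i * x.

(** The affine map that puts the word [w] in front of a representation. *)
Definition G2_word {R : realType} (g0 : R) (w : seq bool) (x : R) : R :=
  foldr (G2_branch g0) x w.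

(** The closed interval of the numbers having a representation with prefix
    [w]. *)
Definition G2_cylinder {R : realType} (g0 : R) (w : seq bool) : set R :=
  [set G2_word g0 w x | x in [set x | 0 <= x <= g0]].

(** The contraction ratio of the branch [i], i.e. the absolute value of
    [G2_g g0 i]. *)
Definition G2_ratio {R : realType} (g0 : R) (i : bool) : R :=
  if i then 1 - g0 else g0.

(** The product of the weights [u] of the letters of [w].  With the contraction
    ratios as weights this is, up to the factor [g0], the length of the
    cylinder of [w]; with the digit probabilities it is the probability of the
    prefix [w]. *)
Definition word_prod {R : realType} (u : bool -> R) (w : seq bool) : R :=
  \prod_(i <- w) u i.

(** The common endpoints of adjacent cylinders: the two branches meet at
    [g0 ^+ 2].  Outside of this countable set the representation is unique. *)
Definition G2_binary {R : realType} (g0 : R) : set R :=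
  [set G2_word g0 w (g0 ^+ 2) | w in [set: seq bool]].

Lemma mkseq_cons (T : Type) (f : nat -> T) n :
  mkseq f n.+1 = f 0%N :: mkseq (fun k => f k.+1) n.
Proof.
by rewrite /mkseq -[iota 0 n.+1]/(0%N :: iota (1 + 0) n) iotaDl /= -map_comp.
Qed.

Lemma word_prod_cons (R : realType) (u : bool -> R) i w :
  word_prod u (i :: w) = u i * word_prod u w.
Proof. by rewrite /word_prod big_cons. Qed.

Lemma word_prod_nil (R : realType) (u : bool -> R) : word_prod u [::] = 1.
Proof. by rewrite /word_prod big_nil. Qed.

Lemma word_prod_gt0 (R : realType) (u : bool -> R) w :
  (forall i, 0 < u i) -> 0 < word_prod u w.
Proof. by move=> u0; apply: prodr_gt0 => i _. Qed.

Section expansion.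
Variables (R : realType) (g0 : R).
Hypothesis hg0 : 2^-1 <= g0 < 1.
Implicit Types (alpha beta : nat -> bool) (w : seq bool).

Let g0gt0 : 0 < g0. Proof. by move: hg0; lra. Qed.

Lemma G2_ratio_gt0 i : 0 < G2_ratio g0 i.
Proof. by case: i => /=; move: hg0; lra. Qed.

Lemma G2_ratio_le i : G2_ratio g0 i <= g0.
Proof. by case: i => /=; move: hg0; lra. Qed.

Lemma G2_ratio_ge i : 1 - g0 <= G2_ratio g0 i.
Proof. by case: i => /=; move: hg0; lra. Qed.

Lemma normr_G2_g i : `|G2_g g0 i| = G2_ratio g0 i.
Proof.
case: i => /=; last by rewrite ger0_norm // ltW.
by rewrite ltr0_norm; move: hg0; lra.
Qed.

Lemma G2_branch_itv i x : 0 <= x <= g0 -> 0 <= G2_branch g0 i x <= g0.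
Proof. by case: i; rewrite /G2_branch /=; move: hg0; nra. Qed.

Lemma G2_word_itv w x : 0 <= x <= g0 -> 0 <= G2_word g0 w x <= g0.
Proof. by move=> hx; elim: w => //= i w IH; exact: G2_branch_itv. Qed.

Lemma G2_branch_inj i : injective (G2_branch g0 i).
Proof.
move=> x y /addrI /mulfI; apply.
by rewrite -normr_eq0 normr_G2_g gt_eqF // G2_ratio_gt0.
Qed.

Lemma dist_G2_word w x y :
  `|G2_word g0 w x - G2_word g0 w y| = word_prod (G2_ratio g0) w * `|x - y|.
Proof.
elim: w => [|i w IH]; first by rewrite word_prod_nil mul1r.
rewrite word_prod_cons -mulrA -IH -normr_G2_g -normrM /=.
by congr (`|_|); rewrite /G2_branch; ring.
Qed.

Let term alpha k := G2_delta g0 (alpha k) * \prod_(j < k) G2_g g0 (alpha j).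

Let psum_cons alpha n : series (term alpha) n.+1 =
  G2_branch g0 (alpha 0%N) (series (term (fun k => alpha k.+1)) n).
Proof.
rewrite /series /= big_nat_recl // /term big_ord0 mulr1; congr (_ + _).
rewrite mulr_sumr; apply: eq_bigr => i _.
by rewrite big_ord_recl /= mulrCA.
Qed.

Let psum_itv alpha n : 0 <= series (term alpha) n <= g0.
Proof.
elim: n alpha => [|n IH] alpha; first by rewrite /series /= big_geq // lexx ltW.
by rewrite psum_cons; exact: G2_branch_itv.
Qed.

Let is_cvg_psum alpha : cvgn (series (term alpha)).
Proof.
apply: normed_cvg; apply: (@series_le_cvg _ _ (geometric g0 g0)).
- by move=> n; exact: normr_ge0.
- by move=> n; rewrite /geometric /= mulr_ge0 ?exprn_ge0 // ltW.
- move=> n; rewrite /geometric /= /term normrM ler_pM //.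
    by case: (alpha n) => /=; rewrite ?normr0 ?ger0_norm // ltW.
  rewrite normr_prod -[X in _ <= X ^+ _](ger0_norm (ltW g0gt0)).
  rewrite -normrX -[in leRHS](card_ord n) -prodr_const normr_prod.
  apply: ler_prod => i _.
  by rewrite normr_ge0 normr_G2_g (ger0_norm (ltW g0gt0)) G2_ratio_le.
- by apply: is_cvg_geometric_series; rewrite ger0_norm ?ltW //; case/andP: hg0.
Qed.

Lemma G2_value_cons alpha :
  G2_value g0 alpha = G2_branch g0 (alpha 0%N) (G2_value g0 (fun k => alpha k.+1)).
Proof.
apply/cvg_lim => //; rewrite -(cvg_shiftS (series _)) /=.
under eq_fun do rewrite psum_cons.
by apply: cvgD; [exact: cvg_cst | apply: cvgM; [exact: cvg_cst|exact: is_cvg_psum]].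
Qed.

Lemma G2_value_itv alpha : 0 <= G2_value g0 alpha <= g0.
Proof.
apply/andP; split.
  by apply: limr_ge; [exact: is_cvg_psum|apply: nearW => n; case/andP: (psum_itv alpha n)].
by apply: limr_le; [exact: is_cvg_psum|apply: nearW => n; case/andP: (psum_itv alpha n)].
Qed.

Lemma G2_value_word alpha n : G2_value g0 alpha =
  G2_word g0 (mkseq alpha n) (G2_value g0 (fun k => alpha (n + k)%N)).
Proof.
elim: n alpha => [//|n IH] alpha.
by rewrite G2_value_cons IH mkseq_cons.
Qed.

Lemma G2_value_cylinder alpha n : G2_cylinder g0 (mkseq alpha n) (G2_value g0 alpha).
Proof.
by exists (G2_value g0 (fun k => alpha (n + k)%N));
  [exact: G2_value_itv | rewrite -G2_value_word].
Qed.

Lemma G2_branch_meet x y : 0 <= x <= g0 -> 0 <= y <= g0 ->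
  G2_branch g0 false x = G2_branch g0 true y -> G2_branch g0 false x = g0 ^+ 2.
Proof.
move=> /andP[_ hx] /andP[_ hy]; rewrite /G2_branch /= => E.
have h1 : 0 <= g0 * (g0 - x) by rewrite mulr_ge0 ?subr_ge0 // ltW.
have h2 : 0 <= (1 - g0) * (g0 - y) by apply: mulr_ge0; move: hg0; lra.
by apply/eqP; rewrite eq_le; apply/andP; split; lra.
Qed.

Lemma G2_branch_binary i x : G2_binary g0 x -> G2_binary g0 (G2_branch g0 i x).
Proof. by move=> [w _ <-]; exists (i :: w). Qed.

Lemma countable_G2_binary : countable (G2_binary g0).
Proof. by apply: sub_countable; [exact: card_image_le | exact: countableP]. Qed.

(** A number outside of [G2_binary] has at most one first digit. *)
Lemma G2_branch_digit i j x y : 0 <= x <= g0 -> 0 <= y <= g0 ->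
  ~ G2_binary g0 (G2_branch g0 i x) ->
  G2_branch g0 i x = G2_branch g0 j y -> i = j.
Proof.
move=> hx hy; have D0 : G2_binary g0 (g0 ^+ 2) by exists [::].
case: i j => [] [] // nD E; exfalso; apply: nD.
  by rewrite E (G2_branch_meet hy hx).
by rewrite (G2_branch_meet hx hy).
Qed.

(** Outside of [G2_binary] a cylinder contains no other numbers than those
    whose representation has the given prefix. *)
Lemma cylinder_prefix alpha w : G2_cylinder g0 w (G2_value g0 alpha) ->
  ~ G2_binary g0 (G2_value g0 alpha) -> mkseq alpha (size w) = w.
Proof.
elim: w alpha => [//|i w IH] alpha [x hx].
rewrite G2_value_cons /= => E nD.
have hi : alpha 0%N = i.
  by exact: G2_branch_digit (G2_value_itv _) (G2_word_itv w hx) nD (esym E).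
rewrite mkseq_cons hi; congr cons; apply: IH.
  by exists x => //; apply: (@G2_branch_inj i); rewrite E hi.
by move=> D; apply: nD; exact: G2_branch_binary.
Qed.

Lemma dist_cylinder_le w x y : G2_cylinder g0 w x -> G2_cylinder g0 w y ->
  `|x - y| <= word_prod (G2_ratio g0) w * g0.
Proof.
move=> [x' hx <-] [y' hy <-]; rewrite dist_G2_word ler_pM2l.
  by rewrite ler_norml; move: hx hy => /= /andP[? ?] /andP[? ?]; apply/andP; split; lra.
by apply: word_prod_gt0 => i; exact: G2_ratio_gt0.
Qed.

Lemma word_prod_ratio_le w : word_prod (G2_ratio g0) w <= g0 ^+ size w.
Proof.
elim: w => [|i w IH]; first by rewrite word_prod_nil expr0.
rewrite word_prod_cons exprS; apply: ler_pM => //.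
- exact/ltW/G2_ratio_gt0.
- by apply/ltW/word_prod_gt0 => j; exact: G2_ratio_gt0.
- exact: G2_ratio_le.
Qed.

Lemma word_prod_ratio_ge w :
  (1 - g0) ^+ size w <= word_prod (G2_ratio g0) w.
Proof.
have g1 : 0 <= 1 - g0 by move: hg0; lra.
elim: w => [|i w IH]; first by rewrite word_prod_nil expr0.
rewrite word_prod_cons exprS; apply: ler_pM => //; first by rewrite exprn_ge0.
exact: G2_ratio_ge.
Qed.

Lemma measurable_G2_cylinder w : measurable (G2_cylinder g0 w).
Proof.
apply: compact_measurable; rewrite /G2_cylinder.
have -> : [set x | 0 <= x <= g0] = `[0, g0]%classic.
  by apply/seteqP; split=> x /=; rewrite in_itv.
apply: continuous_compact; last exact: segment_compact.
apply: continuous_subspaceT; elim: w => [|i w IH] x /=; first exact: cvg_id.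
by apply: cvgD; [exact: cvg_cst | apply: cvgM; [exact: cvg_cst | exact: IH]].
Qed.

End expansion.

(** * Covering an interval by two cylinders of comparable size *)

Section two_cylinders.
Variables (R : realType) (g0 : R).
Hypothesis hg0 : 2^-1 <= g0 < 1.

Let g0gt0 : 0 < g0. Proof. by move: hg0; lra. Qed.
Let g1gt0 : 0 < 1 - g0. Proof. by move: hg0; lra. Qed.

Lemma exists_expr_lt (r : R) : 0 < r -> exists n, g0 ^+ n < r.
Proof.
move=> r0.
have /cvgrPdist_lt /(_ r r0) [n _ /(_ n (leqnn n))] : g0 ^+ n @[n --> \oo] --> 0.
  by apply: cvg_expr; rewrite ger0_norm ?ltW //; case/andP: hg0.
rewrite /= sub0r normrN ger0_norm ?exprn_ge0 ?ltW // => h.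
by exists n.
Qed.

Lemma exists_expr_between (r : R) : 0 < r <= 1 ->
  exists n, g0 ^+ n.+1 < r <= g0 ^+ n.
Proof.
case/andP=> r0 r1; case: (ex_minnP (exists_expr_lt r0)) => -[|n] hn hmin.
  by move: hn; rewrite expr0 ltNge r1.
exists n; rewrite hn /= leNgt; apply/negP => /hmin.
by rewrite ltnn.
Qed.

Let cylinder_false w x : G2_cylinder g0 w (x / g0) ->
  G2_cylinder g0 (false :: w) x.
Proof.
move=> [y hy E]; exists y => //=.
by rewrite E /G2_branch /= add0r mulrC divfK // gt_eqF.
Qed.

Let cylinder_true w x : G2_cylinder g0 w ((g0 - x) / (1 - g0)) ->
  G2_cylinder g0 (true :: w) x.
Proof.
move=> [y hy E]; exists y => //=; rewrite E /G2_branch /=.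
by rewrite -[g0 - 1]opprB mulNr mulrC divfK ?gt_eqF //; ring.
Qed.

(* The cylinders of the words of zeros shrink to the left end of [0, g0]. *)
Let cylinder_left (r : R) : 0 < r <= g0 ->
  exists2 w, word_prod (G2_ratio g0) w <= r / g0 ^+ 2 &
    forall x : R, 0 <= x <= r -> G2_cylinder g0 w x.
Proof.
case/andP=> r0 rg.
have [|k /andP[hk1 hk2]] := @exists_expr_between (r / g0).
  by rewrite divr_gt0 // ler_pdivrMr // mul1r.
exists (nseq k false).
  rewrite /word_prod big_nseq iter_mulr_1 /=.
  move: hk1; rewrite exprS mulrC -ltr_pdivlMr // -mulrA -invfM -expr2.
  exact: ltW.
move=> x /andP[x0 xr]; exists (x / g0 ^+ k).
  have gk0 : 0 < g0 ^+ k by rewrite exprn_gt0.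
  rewrite /= divr_ge0 ?(ltW gk0) //= ler_pdivrMr //.
  by rewrite -ler_pdivrMl // mulrC (le_trans _ hk2) // ler_pM2r ?invr_gt0.
have -> : forall y, G2_word g0 (nseq k false) y = g0 ^+ k * y.
  move=> y; elim: (k) => [|j IH]; first by rewrite expr0 mul1r.
  by rewrite /= IH /G2_branch /= add0r exprS mulrA.
by rewrite mulrC divfK // expf_neq0 // gt_eqF.
Qed.

Let c : R := (1 - g0) * g0 ^+ 2.
Let c0 : 0 < c. Proof. by rewrite mulr_gt0 ?exprn_gt0. Qed.

(* The right end of [0, g0] is the image of the left end under the branch of
   the digit 1. *)
Let cylinder_right (r : R) : 0 < r <= g0 ->
  exists2 w, word_prod (G2_ratio g0) w <= r / c &
    forall x : R, g0 - r <= x <= g0 -> G2_cylinder g0 w x.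
Proof.
move=> hr; have [r0 rg] := andP hr.
have [rs|rs] := leP r ((1 - g0) * g0).
  have [|w hw1 hw2] := @cylinder_left (r / (1 - g0)).
    by rewrite divr_gt0 // ler_pdivrMr // mulrC.
  exists (true :: w).
    rewrite word_prod_cons /= mulrC -ler_pdivlMr // (le_trans hw1) //.
    rewrite mulrAC ler_pM2r ?invr_gt0 // ler_pM2l // lef_pV2 ?posrE ?exprn_gt0 //.
    by rewrite /c ler_piMl ?exprn_ge0 ?(ltW g0gt0) //; lra.
  move=> x /andP[x1 x2]; apply: cylinder_true; apply: hw2.
  by rewrite divr_ge0 ?(ltW g1gt0) ?subr_ge0 //= ler_pM2r ?invr_gt0 //; lra.
exists [::].
  rewrite word_prod_nil ler_pdivlMr // mul1r (le_trans _ (ltW rs)) //.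
  by rewrite /c expr2 mulrA ler_piMr ?mulr_ge0 // ?ltW //; case/andP: hg0.
by move=> x /andP[x1 x2]; exists x => //=; lra.
Qed.

Let scaled_le (q t s : R) : 0 < q -> t <= s / q / c -> q * t <= s / c.
Proof. by move=> q0; rewrite mulrAC ler_pdivlMr // mulrC. Qed.

(** Descending through the cylinders, the interval is blown up until it meets
    both first-level cylinders; what lies in each of them then touches their
    common endpoint. *)
Lemma two_cylinders (a b : R) : 0 <= a -> a < b -> b <= g0 ->
  exists v w, [/\ word_prod (G2_ratio g0) v <= (b - a) / ((1 - g0) * g0 ^+ 2),
    word_prod (G2_ratio g0) w <= (b - a) / ((1 - g0) * g0 ^+ 2) &
    forall x : R, a <= x <= b -> G2_cylinder g0 v x \/ G2_cylinder g0 w x].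
Proof.
move=> a0 ab bg; rewrite -/c.
have [k hk] : exists k, g0 ^+ k < b - a by apply: exists_expr_lt; rewrite subr_gt0.
elim: k a b a0 ab bg hk => [|k IH] a b a0 ab bg hk.
  by move: hk hg0; rewrite expr0; lra.
have [b2|b2] := leP b (g0 ^+ 2).
  have E : b / g0 - a / g0 = (b - a) / g0 by rewrite mulrBl.
  have [||||v [w [h1 h2 h3]]] := IH (a / g0) (b / g0).
  - by rewrite divr_ge0 // ltW.
  - by rewrite ltr_pM2r ?invr_gt0.
  - by rewrite ler_pdivrMr // -expr2.
  - by rewrite E ltr_pdivlMr // -exprSr.
  exists (false :: v), (false :: w); rewrite !word_prod_cons /=; split.
  - by apply: scaled_le => //; rewrite -E.
  - by apply: scaled_le => //; rewrite -E.
  - move=> x /andP[x1 x2]; have [||] := h3 (x / g0).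
    + by rewrite !ler_pM2r ?invr_gt0 // x1.
    + by left; exact: cylinder_false.
    + by right; exact: cylinder_false.
have [a2|a2] := leP (g0 ^+ 2) a.
  set q := 1 - g0.
  have E : (g0 - a) / q - (g0 - b) / q = (b - a) / q.
    by rewrite -mulrBl; congr (_ / _); ring.
  have [||||v [w [h1 h2 h3]]] := IH ((g0 - b) / q) ((g0 - a) / q).
  - by apply: divr_ge0; [lra | exact: ltW].
  - by rewrite ltr_pM2r ?invr_gt0 //; lra.
  - by rewrite ler_pdivrMr // /q; move: a2; rewrite expr2; lra.
  - rewrite E ltr_pdivlMr // (le_lt_trans _ hk) // exprSr ler_pM2l ?exprn_gt0 //.
    by rewrite /q; move: hg0; lra.
  exists (true :: v), (true :: w); rewrite !word_prod_cons /=; split.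
  - by apply: scaled_le => //; rewrite -E.
  - by apply: scaled_le => //; rewrite -E.
  - move=> x /andP[x1 x2]; have [||] := h3 ((g0 - x) / q).
    + by rewrite !ler_pM2r ?invr_gt0 //; lra.
    + by left; exact: cylinder_true.
    + by right; exact: cylinder_true.
have [|v hv1 hv2] := @cylinder_right ((g0 ^+ 2 - a) / g0).
  apply/andP; split; first by apply: divr_gt0; lra.
  by rewrite ler_pdivrMr // -expr2; lra.
have [|w hw1 hw2] := @cylinder_right ((b - g0 ^+ 2) / (1 - g0)).
  apply/andP; split; first by rewrite divr_gt0 // subr_gt0.
  by rewrite ler_pdivrMr //; move: bg; rewrite expr2; lra.
exists (false :: v), (true :: w); rewrite !word_prod_cons /=; split.
- apply: le_trans (scaled_le g0gt0 hv1) _.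
  by rewrite ler_pM2r ?invr_gt0 //; lra.
- apply: le_trans (scaled_le g1gt0 hw1) _.
  by rewrite ler_pM2r ?invr_gt0 //; lra.
- move=> x /andP[x1 x2]; have [xs|xs] := leP x (g0 ^+ 2).
    left; apply: cylinder_false; apply: hv2; apply/andP; split.
      by rewrite ler_pdivlMr // mulrBl divfK ?gt_eqF // -expr2; lra.
    by rewrite ler_pdivrMr // -expr2.
  right; apply: cylinder_true; apply: hw2; apply/andP; split.
    by rewrite ler_pdivlMr // mulrBl divfK ?gt_eqF // expr2; lra.
  by rewrite ler_pdivrMr //; move: xs; rewrite expr2; lra.
Qed.

End two_cylinders.

(** * Digit frequencies *)

Lemma digit_countE (alpha : nat -> bool) i n :
  digit_count alpha i n = count_mem i (mkseq alpha n).
Proof.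
have T m : (\sum_(j < m) alpha j)%N = count_mem true (mkseq alpha m).
  elim: m => [|m IH]; first by rewrite big_ord0.
  by rewrite big_ord_recr IH mkseqS -cats1 count_cat /= addn0; case: (alpha m).
rewrite /digit_count; case: i; first exact: T.
rewrite T -[X in (X - _)%N](size_mkseq alpha n) -(count_predC (pred1 true)) addKn.
by apply: eq_count => -[].
Qed.

Lemma digit_countS (alpha : nat -> bool) i n : digit_count alpha i n.+1 =
  ((alpha 0%N == i) + digit_count (fun k => alpha k.+1) i n)%N.
Proof. by rewrite !digit_countE mkseq_cons. Qed.

Lemma digit_countC (alpha : nat -> bool) n :
  (digit_count alpha false n + digit_count alpha true n = n)%N.
Proof.
rewrite !digit_countE -[RHS](size_mkseq alpha n) -(count_predC (pred1 false)).
by congr (_ + _)%N; apply: eq_count => -[].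
Qed.

Section frequency.
Variable R : realType.
Implicit Types (alpha : nat -> bool) (l : R).

Lemma word_prod_count (u : bool -> R) w : word_prod u w =
  u false ^+ count_mem false w * u true ^+ count_mem true w.
Proof.
elim: w => [|[] w IH]; first by rewrite word_prod_nil !expr0 mulr1.
- by rewrite word_prod_cons IH /= add0n add1n exprS mulrCA.
- by rewrite word_prod_cons IH /= add0n add1n exprS mulrA.
Qed.

(** The frequency of the digit [false] in [alpha] is [l]. *)
Definition has_frequency alpha l : Prop :=
  (fun k : nat => (digit_count alpha false k)%:R / k%:R : R) @ \oo --> l.

Lemma cvg_ln_word_prod (u : bool -> R) alpha l : (forall i, 0 < u i) ->
  has_frequency alpha l ->
  ln (word_prod u (mkseq alpha n)) / n%:R @[n --> \oo] -->
    l * ln (u false) + (1 - l) * ln (u true).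
Proof.
move=> u0 hl.
have h1 : (digit_count alpha true n)%:R / n%:R @[n --> \oo] --> 1 - l.
  rewrite -cvg_shiftS /=.
  have -> : (fun n => (digit_count alpha true n.+1)%:R / n.+1%:R : R) =
      (fun n => 1 - (digit_count alpha false n.+1)%:R / n.+1%:R).
    apply/funext => n; rewrite -[X in (digit_count _ true _)%:R / X](natr1) natr1.
    apply: (mulIf (x := n.+1%:R)); rewrite ?pnatr_eq0 //.
    rewrite mulrBl !divfK ?pnatr_eq0 // mul1r -{2}(digit_countC alpha n.+1) natrD.
    by rewrite addrC addKr.
  by apply: cvgB; [exact: cvg_cst | move: hl; rewrite /has_frequency -cvg_shiftS].
have -> : (fun n => ln (word_prod u (mkseq alpha n)) / n%:R) =
   (fun n => (digit_count alpha false n)%:R / n%:R * ln (u false) +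
             (digit_count alpha true n)%:R / n%:R * ln (u true)).
  apply/funext => n; rewrite word_prod_count -!digit_countE.
  by rewrite lnM ?posrE ?exprn_gt0 // !lnXn // -(mulr_natl (ln (u false)))
    -(mulr_natl (ln (u true))) mulrDl mulrAC [in X in _ + X]mulrAC.
by apply: cvgD; apply: cvgM => //; exact: cvg_cst.
Qed.

Lemma has_frequency_shift alpha l :
  has_frequency alpha l <-> has_frequency (fun k => alpha k.+1) l.
Proof.
set beta := fun k => alpha k.+1.
have S n : (digit_count alpha false n.+1)%:R =
    (alpha 0%N == false)%:R + (digit_count beta false n)%:R :> R.
  by rewrite digit_countS natrD.
have H (a : R) : a / n.+1%:R @[n --> \oo] --> (0 : R).
  rewrite -(mulr0 a); apply: cvgM; [exact: cvg_cst | exact: cvg_harmonic].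
rewrite /has_frequency; split=> h.
- rewrite -cvg_shiftS /=.
  have -> : (fun n => (digit_count beta false n.+1)%:R / n.+1%:R : R) =
     (fun n => (digit_count alpha false n.+2)%:R / n.+2%:R * (1 + 1 / n.+1%:R)
       - (alpha 0%N == false)%:R / n.+1%:R).
    apply/funext => n; rewrite S.
    have n1 : n.+1%:R != 0 :> R by rewrite pnatr_eq0.
    have n2 : n.+2%:R != 0 :> R by rewrite pnatr_eq0.
    move: n1 n2; rewrite -(natr1 n.+1); move: (n.+1%:R) => a a0 a1.
    by field; rewrite a0.
  suff : (digit_count alpha false n.+2)%:R / n.+2%:R * (1 + 1 / n.+1%:R)
      - (alpha 0%N == false)%:R / n.+1%:R @[n --> \oo] --> l * (1 + 0) - 0.
    by rewrite addr0 mulr1 subr0.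
  apply: cvgB; last exact: H.
  apply: cvgM; last by apply: cvgD; [exact: cvg_cst|exact: H].
  by move: h; rewrite -cvg_shiftS -cvg_shiftS.
- rewrite -cvg_shiftS /=.
  have -> : (fun n => (digit_count alpha false n.+1)%:R / n.+1%:R : R) =
     (fun n => (alpha 0%N == false)%:R / n.+1%:R +
       (digit_count beta false n)%:R / n%:R * (1 - 1 / n.+1%:R)).
    apply/funext => n; rewrite S.
    have n1 : n.+1%:R != 0 :> R by rewrite pnatr_eq0.
    case: n n1 => [|n] n1.
      by rewrite !digit_countE /= ?mulr0n !mul0r !addr0.
    have n2 : n.+1%:R != 0 :> R by rewrite pnatr_eq0.
    move: n1 n2; rewrite -(natr1 n.+1); move: (n.+1%:R) => a a1 a0.
    by field; rewrite a0 a1.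
  suff : (alpha 0%N == false)%:R / n.+1%:R + (digit_count beta false n)%:R / n%:R *
      (1 - 1 / n.+1%:R) @[n --> \oo] --> 0 + l * (1 - 0).
    by rewrite subr0 mulr1 add0r.
  apply: cvgD; first exact: H.
  by apply: cvgM => //; apply: cvgB; [exact: cvg_cst|exact: H].
Qed.

End frequency.

(** * Independent identically distributed digits *)

Lemma measurable_bigcup_count d (T : measurableType d) (U : countType)
    (D : set U) (F : U -> set T) :
  (forall i, D i -> measurable (F i)) -> measurable (\bigcup_(i in D) F i).
Proof.
move=> mF; rewrite bigcup_mkcond; apply: countable_bigcupT_measurable => // i.
by case: ifPn => // /set_mem; exact: mF.
Qed.

Section iid_digits.
Variables (R : realType) (d : measure_display) (Omega : measurableType d).
Variables (P : probability Omega R) (xi : nat -> {RV P >-> bool}) (p : bool -> R).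
Hypothesis hindep : mutually_independent xi.
Hypothesis hp : p false + p true = 1.
Hypothesis hdist : forall n i, P [set w | xi n w = i] = (p i)%:E.

(** The digit sequence at an outcome. *)
Definition digits (w : Omega) : nat -> bool := fun n => xi n w.

Lemma digit_prob_ge0 i : 0 <= p i.
Proof. by rewrite -lee_fin -(hdist 0). Qed.

(** The event that [w] is a prefix of the digit sequence. *)
Definition prefix_event (w : seq bool) : set Omega :=
  [set o | mkseq (digits o) (size w) = w].

Let prefix_eventE w : prefix_event w =
  \bigcap_(n in [set` iota 0 (size w)]) (xi n @^-1` [set nth false w n]).
Proof.
apply/seteqP; split=> [ o <- n|o h].
  by rewrite /= size_mkseq mem_iota add0n => hn; rewrite nth_mkseq.
apply: (@eq_from_nth _ false); rewrite size_mkseq // => i hi.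
by rewrite nth_mkseq //; apply: (h i) => /=; rewrite mem_iota.
Qed.

Lemma measurable_prefix_event w : measurable (prefix_event w).
Proof.
rewrite prefix_eventE; apply: fin_bigcap_measurable => // n _.
by rewrite -[X in measurable X]setTI; apply: measurable_funPT.
Qed.

Lemma prefix_event_prob w : P (prefix_event w) = (word_prod p w)%:E.
Proof.
rewrite prefix_eventE hindep ?iota_uniq //.
rewrite (eq_bigr (fun n => (p (nth false w n))%:E)); last by move=> n _; exact: hdist.
rewrite prodEFin; congr EFin.
by rewrite /word_prod [RHS](big_nth false) /index_iota subn0.
Qed.

Lemma measurable_prefix_pred (good : pred (seq bool)) n :
  measurable [set o | good (mkseq (digits o) n)].
Proof.
have -> : [set o | good (mkseq (digits o) n)] =
    \bigcup_(w in [set w | size w = n /\ good w]) prefix_event w.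
  apply/seteqP; split=> [ o /= h|o [w [<- gw] /= E]]; last by rewrite /= E.
  by exists (mkseq (digits o) n); rewrite ?size_mkseq //= /prefix_event /= size_mkseq.
by apply: measurable_bigcup_count => w _; exact: measurable_prefix_event.
Qed.

(** The probability that the first [n] digits form a good word is at most
    [(q false + q true) ^+ n] for every weight [q] under which every good word
    of length [n] has at least the mass it has under the law of the digits.
    For an exponential tilt [q] this is Chernoff's bound. *)
Lemma prefix_pred_prob_le (q : bool -> R) (good : pred (seq bool)) n :
  (forall i, 0 <= q i) ->
  (forall w, size w = n -> good w -> word_prod p w <= word_prod q w) ->
  (P [set o | good (mkseq (digits o) n)] <= ((q false + q true) ^+ n)%:E)%E.
Proof.
move=> q0 hq; pose word (f : {ffun 'I_n -> bool}) := [seq f i | i <- enum 'I_n].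
have size_word f : size (word f) = n by rewrite size_map size_enum_ord.
have E : [set o | good (mkseq (digits o) n)] `<=`
    \big[setU/set0]_(f : {ffun 'I_n -> bool} | good (word f)) prefix_event (word f).
  move=> o /= ho; pose f := [ffun i : 'I_n => digits o i].
  have fE : word f = mkseq (digits o) n.
    rewrite /mkseq -val_enum_ord -map_comp; apply: eq_map => i /=.
    by rewrite ffunE.
  by rewrite (bigD1 f) /= ?fE //; left; rewrite /prefix_event /= size_mkseq.
have [mU PU] : measurable (\big[setU/set0]_(f : {ffun 'I_n -> bool} | good (word f))
      prefix_event (word f)) /\
    (P (\big[setU/set0]_(f : {ffun 'I_n -> bool} | good (word f))
      prefix_event (word f)) <=
    (\sum_(f : {ffun 'I_n -> bool} | good (word f)) word_prod q (word f))%:E)%E.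
  elim/big_rec2: _ => [|f s A gf [mA PA]]; first by rewrite measure0.
  have mf := measurable_prefix_event (word f).
  split; first exact: measurableU.
  rewrite EFinD (le_trans (measureU2 _ _ _)) // leeD //.
  apply: (@le_trans _ _ (word_prod p (word f))%:E); last by rewrite lee_fin hq.
  by rewrite -prefix_event_prob.
apply: (le_trans (le_measure P _ _ E)); rewrite ?inE //.
  exact: measurable_prefix_pred.
apply: (le_trans PU); rewrite lee_fin.
have -> : (q false + q true) ^+ n =
    \sum_(f : {ffun 'I_n -> bool}) word_prod q (word f).
  transitivity (\prod_(i < n) \sum_(b : bool) q b).
    by rewrite prodr_const card_ord big_bool addrC.
  rewrite bigA_distr_bigA /=; apply: eq_bigr => f _.
  by rewrite /word_prod big_map big_enum.
rewrite [leRHS](bigID (fun f => good (word f))) /= lerDl.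
by apply: sumr_ge0 => f _; apply: prodr_ge0.
Qed.

(* The expectation of the tilted weight of a digit.  Tilting by [e] itself is
   good enough, as shown by the bound 1 / (1 - y) for exp y. *)
Let chernoff_base_lt1 (x e : R) : 0 <= x <= 1 -> 0 < e < 1 ->
  x * expR (e * (1 - (x + e))) + (1 - x) * expR (e * - (x + e)) < 1.
Proof.
move=> hx he.
have H y : y < 1 -> expR y <= (1 - y)^-1.
  move=> y1; rewrite -[y in leLHS]opprK expRN lef_pV2 ?posrE ?expR_gt0 ?subr_gt0 //.
  exact: expR_ge1Dx.
have a1 : e * (1 - (x + e)) < 1 by nra.
have b1 : e * - (x + e) < 1 by nra.
apply: (@le_lt_trans _ _ (x * (1 - e * (1 - (x + e)))^-1 +
    (1 - x) * (1 - e * - (x + e))^-1)).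
  by apply: lerD; apply: ler_wpM2l; rewrite ?H //; move: hx; lra.
move: a1 b1; rewrite -subr_gt0 => a1; rewrite -subr_gt0 => b1.
have -> : x * (1 - e * (1 - (x + e)))^-1 + (1 - x) * (1 - e * - (x + e))^-1 =
  (x * (1 - e * - (x + e)) + (1 - x) * (1 - e * (1 - (x + e)))) /
  ((1 - e * (1 - (x + e))) * (1 - e * - (x + e))).
  by field; rewrite !gt_eqF.
rewrite ltr_pdivrMr ?mulr_gt0 // mul1r -subr_gt0.
have -> : (1 - e * (1 - (x + e))) * (1 - e * - (x + e)) -
  (x * (1 - e * - (x + e)) + (1 - x) * (1 - e * (1 - (x + e)))) =
  e ^+ 2 * ((x + e - 1 / 2) ^+ 2 + 3 / 4) by field.
by rewrite mulr_gt0 ?exprn_gt0 //; [case/andP: he | rewrite ltr_wpDl ?sqr_ge0].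
Qed.

(* The outcomes for which the digit [i] occurs too often among the first [n]
   digits. *)
Let excess i (e : R) n : set Omega :=
  [set o | n%:R * (p i + e) <= (count_mem i (mkseq (digits o) n))%:R].

Let measurable_excess i e n : measurable (excess i e n).
Proof.
exact: (measurable_prefix_pred (fun w => n%:R * (p i + e) <= (count_mem i w)%:R)).
Qed.

Let excess_prob_le i e : 0 < e < 1 ->
  exists2 r : R, 0 < r < 1 & forall n, (P (excess i e n) <= (r ^+ n)%:E)%E.
Proof.
move=> he; pose q j := p j * expR (e * ((j == i)%:R - (p i + e))).
have pE : p (~~ i) = 1 - p i by case: (i) hp => /= <-; ring.
have p1 : 0 <= p i <= 1.
  by rewrite digit_prob_ge0 /= -subr_ge0 -pE digit_prob_ge0.
have qE : q false + q true = p i * expR (e * (1 - (p i + e))) +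
    (1 - p i) * expR (e * - (p i + e)).
  by rewrite -pE /q; case: (i); rewrite /= ?sub0r // addrC.
exists (q false + q true).
  rewrite qE chernoff_base_lt1 // andbT.
  have [->|p0] := eqVneq (p i) 0; first by rewrite mul0r add0r subr0 mul1r expR_gt0.
  rewrite ltr_wpDr ?mulr_ge0 ?expR_ge0 ?mulr_gt0 ?expR_gt0 //.
    by case/andP: p1; lra.
  by rewrite lt_def p0 digit_prob_ge0.
move=> n.
apply: (prefix_pred_prob_le (good := fun w => n%:R * (p i + e) <= (count_mem i w)%:R)).
  by move=> j; rewrite mulr_ge0 ?expR_ge0 ?digit_prob_ge0.
move=> w sw hw.
have -> : word_prod q w = word_prod p w *
    expR (e * ((count_mem i w)%:R - (size w)%:R * (p i + e))).
  elim: (w) => [|j v IH]; first by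
    rewrite !word_prod_nil /= mul0r subr0 mulr0 expR0 mulr1.
  rewrite !word_prod_cons IH {1}/q mulrACA -expRD; congr (_ * expR _).
  by rewrite /= natrD -natr1; ring.
rewrite ler_peMr //; first by apply: prodr_ge0 => j _; exact: digit_prob_ge0.
apply: le_trans (expR_ge1Dx _); rewrite lerDl sw mulr_ge0 ?subr_ge0 //.
by case/andP: he => /ltW.
Qed.

(** The strong law of large numbers for the digits. *)
Lemma strong_law_digits :
  P.-negligible (~` [set o | has_frequency (digits o) (p false)]).
Proof.
(* The shift by 2 keeps the deviations below 1. *)
pose e (k : nat) : R := k.+2%:R^-1.
have e01 k : 0 < e k < 1 by rewrite invr_gt0 ltr0n /= invf_lt1 ?ltr0n // ltr1n.
pose bad k i := lim_sup_set (excess i (e k)).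
have bad0 k i : P.-negligible (bad k i).
  have [r /andP[r0 r1] hr] := excess_prob_le i (e01 k).
  exists (bad k i); split=> //.
    by apply: bigcapT_measurable => n; apply: bigcup_measurable => j _.
  apply: lim_sup_set_cvg0 => //.
  apply: (@le_lt_trans _ _ (\sum_(n <oo) (r ^+ n)%:E)%E).
    by apply: lee_nneseries => n _ //; exact: hr.
  have := @cvg_geometric_series R 1 r; rewrite ger0_norm ?ltW // => /(_ r1) hc.
  rewrite (_ : (\sum_(n <oo) (r ^+ n)%:E)%E = (1 / (1 - r))%:E) ?ltry //.
  apply/cvg_lim => //.
  have -> : (fun n => (\sum_(0 <= k < n) (r ^+ k)%:E)%E) =
     EFin \o series (geometric 1 r).
    apply/funext => n; rewrite /= /series /= sumEFin; congr EFin.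
    by apply: eq_bigr => j _; rewrite /geometric /= mul1r.
  by apply: cvg_EFin; [exact: nearW|exact: hc].
apply: (@negligibleS _ _ _ _ (\bigcup_k (bad k false `|` bad k true))); last first.
  by apply: negligible_bigcup => k; exact: negligibleU.
move=> o /= hno; apply: contrapT => hbad; apply: hno.
(* An excess of the digit 1 is a deficit of the digit 0, so that the upper
   bounds for both digits squeeze the frequency. *)
have ev i k : \forall n \near \oo,
    (count_mem i (mkseq (digits o) n))%:R < n%:R * (p i + e k).
  have : ~ bad k i o.
    by move=> h; apply: hbad; exists k => //; case: (i) h; [right|left].
  rewrite /bad /lim_sup_set /bigcap /= => /existsNP[m] /not_implyP [_ hm].
  exists m => // n /= mn; rewrite ltNge; apply/negP => hn.
  by apply: hm; exists n.
apply/cvgrPdist_lt => eps eps0.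
have [k hk] : exists k, e k < eps.
  have [k hk] := ltr_add_invr (y := 0) (x := eps) eps0.
  exists k; rewrite add0r in hk; apply: le_lt_trans hk.
  by rewrite lef_pV2 ?posrE ?ltr0n // ler_nat.
have := ev false k; have := ev true k; apply: filterS2 => n ht hf.
have n0 : 0 < n%:R :> R.
  by rewrite ltr0n lt0n; apply: contraTneq hf => ->; rewrite /= mul0r ltxx.
have /(congr1 (fun m => m%:R : R)) := digit_countC (digits o) n.
rewrite !digit_countE natrD => hn.
rewrite distrC ltr_norml ltrBrDr ltrBlDr ltr_pdivlMr // ltr_pdivrMr //.
have h1 := ltr_pM2l n0 (e k) eps; rewrite hk in h1.
move: hp (congr1 ( *%R n%:R) hp); rewrite mulrDr mulr1 => hp1 hp2.
by apply/andP; split; move: hf ht hn h1 hp2; rewrite mulrC !mulrDr; lra.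
Qed.

End iid_digits.

(** * Measurability of the Besicovitch-Eggleston set *)

Section besicovitch_eggleston_measurable.
Variables (R : realType) (g0 : R).
Hypothesis hg0 : 2^-1 <= g0 < 1.

Let g0gt0 : 0 < g0. Proof. by move: hg0; lra. Qed.
Let g1gt0 : 0 < 1 - g0. Proof. by move: hg0; lra. Qed.

(** Every number of [0, g0] has a G2-representation. *)
Lemma G2_value_surj x : 0 <= x <= g0 -> exists alpha, x = G2_value g0 alpha.
Proof.
pose digit (y : R) := g0 ^+ 2 < y.
pose T (y : R) := if digit y then (g0 - y) / (1 - g0) else y / g0.
have T_itv y : 0 <= y <= g0 -> 0 <= T y <= g0.
  rewrite /T /digit => /andP[y0 yg]; case: ltP => hy.
    apply/andP; split; first by rewrite divr_ge0 ?(ltW g1gt0) // subr_ge0.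
    by rewrite ler_pdivrMr //; move: hy; rewrite expr2; lra.
  apply/andP; split; first by apply: divr_ge0 => //; exact: ltW.
  by rewrite ler_pdivrMr // -expr2.
have TK y : G2_branch g0 (digit y) (T y) = y.
  rewrite /T; case: (digit y); rewrite /G2_branch /=.
    by rewrite -[g0 - 1]opprB mulNr mulrC divfK ?gt_eqF //; ring.
  by rewrite add0r mulrC divfK // gt_eqF.
move=> hx; pose alpha n := digit (iter n T x); exists alpha.
have iter_itv n : 0 <= iter n T x <= g0 by elim: n => //= n; exact: T_itv.
have xE n : x = G2_word g0 (mkseq alpha n) (iter n T x).
  elim: n => [//|n IH]; rewrite mkseqS -cats1 /G2_word foldr_cat /= TK.
  exact: IH.
apply/eqP/negP => /negP xne.
have x0 : 0 < `|x - G2_value g0 alpha| by rewrite normr_gt0 subr_eq0.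
have [n hn] := exists_expr_lt hg0 x0.
move: hn; rewrite ltNge => /negP; apply.
rewrite [X in `|X - _|](xE n) (G2_value_word hg0 alpha n) dist_G2_word //.
rewrite -[leRHS]mulr1; apply: ler_pM => //.
- by apply/ltW/word_prod_gt0 => j; exact: G2_ratio_gt0.
- by rewrite (le_trans (word_prod_ratio_le hg0 _)) // size_mkseq.
- have /andP[v0 v1] := G2_value_itv hg0 (fun k => alpha (n + k)%N).
  have /andP[i0 i1] := iter_itv n.
  by rewrite ler_norml; apply/andP; split; move: hg0; lra.
Qed.

Lemma measurable_besicovitch_eggleston p0 :
  measurable (besicovitch_eggleston g0 p0).
Proof.
set B := besicovitch_eggleston g0 p0; set D := G2_binary g0.
have cD : countable D := countable_G2_binary g0.
pose good k n (w : seq bool) :=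
  size w = n /\ `|p0 - (count_mem false w)%:R / n%:R| < k.+1%:R^-1.
pose S := \bigcap_k \bigcup_N \bigcap_(n in [set n | (N <= n)%N])
  \bigcup_(w in good k n) G2_cylinder g0 w.
have mS : measurable S.
  apply: bigcapT_measurable => k; apply: bigcupT_measurable => N.
  apply: bigcap_measurableType => n _; apply: measurable_bigcup_count => w _.
  exact: measurable_G2_cylinder.
(* The set S only tests whether [x] lies in cylinders with good words; outside
   of D these words are the prefixes of its unique representation. *)
have -> : B = (S `\` D) `|` (B `&` D).
  apply/seteqP; split=> x; last first.
    case=> [[Sx nDx]|[]//].
    have hx : 0 <= x <= g0.
      have [N _ /(_ N) /(_ (leqnn N)) [w _ [y hy <-]]] := Sx 0%N I.
      exact: G2_word_itv.
    have [alpha xE] := G2_value_surj hx.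
    split=> //; exists alpha => //; apply/cvgrPdist_lt => eps eps0.
    have [k hk] := ltr_add_invr (y := 0) (x := eps) eps0; rewrite add0r in hk.
    have [N _ hN] := Sx k I.
    exists N => // n Nn; have [w [sw hw] Iw] := hN n Nn.
    have pw : mkseq alpha n = w.
      by rewrite -sw; apply: (cylinder_prefix hg0); rewrite -xE.
    by rewrite digit_countE pw; exact: lt_trans hk.
  move=> Bx; have [Dx|nDx] := pselect (D x); first by right.
  left; split=> // k _; have [hx [alpha xE /cvgrPdist_lt hf]] := Bx.
  have [|N _ hN] := hf k.+1%:R^-1; first by rewrite invr_gt0 ltr0n.
  exists N => // n Nn; exists (mkseq alpha n); last first.
    by rewrite xE; exact: G2_value_cylinder.
  by split; rewrite ?size_mkseq // -digit_countE; exact: hN.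
apply: measurableU; first by apply: measurableD => //; exact: countable_measurable cD.
apply: countable_measurable => //; apply: sub_countable cD.
by apply: subset_card_le => x [].
Qed.

End besicovitch_eggleston_measurable.

(** * Hausdorff measure and dimension of subsets of the line *)

Section hausdorff.
Variable R : realType.
Implicit Types (s e r : R) (U E : set R).
Local Open Scope ereal_scope.

Lemma hausdorff_cost_ge0 s U : 0 <= hausdorff_cost s U.
Proof. by rewrite /hausdorff_cost; case: ifP => // _; exact: poweR_ge0. Qed.

Lemma diam_ge U x y : U x -> U y -> `|x - y|%:E <= diam U.
Proof. by move=> Ux Uy; apply: ereal_sup_ubound; exists x => //; exists y. Qed.

Lemma diam_ge0 U : U !=set0 -> 0 <= diam U.
Proof. by case=> x Ux; apply: le_trans (diam_ge Ux Ux); rewrite lee_fin. Qed.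

Lemma diam_le U r : (forall x y, U x -> U y -> (`|x - y| <= r)%R) ->
  diam U <= r%:E.
Proof. by move=> h; apply: ge_ereal_sup => _ [x Ux [y Uy <-]]; rewrite lee_fin h. Qed.

Lemma hausdorff_cost_le s U r : (0 <= s)%R -> (0 <= r)%R ->
  diam U <= r%:E -> hausdorff_cost s U <= (r `^ s)%:E.
Proof.
move=> s0 r0 h; rewrite /hausdorff_cost; case: eqP => [_|/eqP/set0P U0].
  by rewrite lee_fin powR_ge0.
rewrite -poweR_EFin; apply: gt0_ler_poweR => //; rewrite in_itv /= ?leey andbT.
  exact: diam_ge0.
by rewrite lee_fin.
Qed.

Lemma hausdorff_premeasure_ge0 s e E : 0 <= hausdorff_premeasure s e E.
Proof.
apply: le_ereal_inf_tmp => _ [U _ <-].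
by apply: nneseries_ge0 => n _ _; exact: hausdorff_cost_ge0.
Qed.

Lemma hausdorff_measure_eq0 s E :
  (forall e r, (0 < e)%R -> (0 < r)%R -> exists U : nat -> set R,
    [/\ E `<=` \bigcup_n U n, forall n, diam (U n) <= e%:E &
      \sum_(0 <= n <oo) hausdorff_cost s (U n) <= r%:E]) ->
  hausdorff_measure s E = 0.
Proof.
move=> H; have H0 e : (0 < e)%R -> hausdorff_premeasure s e E = 0.
  move=> e0; apply/eqP; rewrite eq_le hausdorff_premeasure_ge0 andbT.
  apply/lee_addgt0Pr => r r0; rewrite add0e; have [U [h1 h2 h3]] := H e r e0 r0.
  by apply: ge_ereal_inf; eexists; [exists U | exact: h3].
apply/eqP; rewrite eq_le; apply/andP; split.
  by apply: ge_ereal_sup => _ [e /= e0 <-]; rewrite H0.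
by rewrite -(H0 1%R ltr01); apply: ereal_sup_ubound; exists 1%R => //=.
Qed.

Lemma hausdorff_measure0_cover s E e r : hausdorff_measure s E = 0 ->
  (0 < e)%R -> (0 < r)%R -> exists U : nat -> set R,
    [/\ E `<=` \bigcup_n U n, forall n, diam (U n) <= e%:E &
      \sum_(0 <= n <oo) hausdorff_cost s (U n) < r%:E].
Proof.
move=> H0 e0 r0; have : hausdorff_premeasure s e E < r%:E.
  apply: le_lt_trans (_ : _ <= 0) _; last by rewrite lte_fin.
  by rewrite -H0; apply: ereal_sup_ubound; exists e.
by move=> /ereal_inf_lt[_ [U [h1 h2] <-] h3]; exists U.
Qed.

Lemma hausdorff_dim_le s E : (0 <= s)%R -> hausdorff_measure s E = 0 ->
  hausdorff_dim E <= s%:E.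
Proof. by move=> s0 H0; apply: ereal_inf_lbound; exists s. Qed.

Lemma hausdorff_dim_eq (a : R) E : (0 <= a)%R ->
  (forall s, (a < s)%R -> hausdorff_measure s E = 0) ->
  (forall s, (0 <= s < a)%R -> hausdorff_measure s E <> 0) ->
  hausdorff_dim E = a%:E.
Proof.
move=> a0 h1 h2; apply/eqP; rewrite eq_le; apply/andP; split.
  apply/lee_addgt0Pr => e e0; rewrite -EFinD; apply: hausdorff_dim_le.
    by rewrite addr_ge0 // ltW.
  by apply: h1; rewrite ltrDl.
apply: le_ereal_inf_tmp => _ [s [s0 H0] <-]; rewrite lee_fin leNgt.
by apply/negP => sa; apply: (h2 s) => //; rewrite s0.
Qed.

Lemma hausdorff_measure_subset1 s E x : (0 < s)%R -> E `<=` [set x] ->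
  hausdorff_measure s E = 0.
Proof.
move=> s0 Ex; apply: hausdorff_measure_eq0 => e r e0 r0; exists (fun=> [set x]).
have d0 : diam [set x] <= 0%:E.
  by apply: diam_le => _ _ -> ->; rewrite subrr normr0.
split=> [y /Ex ->|n|]; first by exists 0%N.
  by apply: le_trans d0 _; rewrite lee_fin ltW.
rewrite eseries0 ?lee_fin ?ltW // => n _ _.
apply/eqP; rewrite eq_le hausdorff_cost_ge0 andbT.
have := hausdorff_cost_le (ltW s0) (lexx 0%R) d0.
by rewrite powR0 // gt_eqF.
Qed.

(** The mass distribution principle: if the sets of small diameter have mass at
    most proportional to their cost, then a null set for the Hausdorff measure
    carries no mass. *)
Lemma mass_distribution d (T : measurableType d) (mu : {measure set T -> \bar R})
    (f : T -> R) (A : set T) E s e (C : R) : (0 < e)%R -> (0 <= C)%R ->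
  measurable A -> f @` A `<=` E -> hausdorff_measure s E = 0 ->
  (forall U, diam U <= e%:E -> exists V : set T,
    [/\ measurable V, A `&` f @^-1` U `<=` V &
      mu V <= C%:E * hausdorff_cost s U]) ->
  mu A = 0.
Proof.
move=> e0 C0 mA fA H0 H.
have C1 : (0 < C + 1)%R by rewrite ltr_wpDl.
apply/eqP; rewrite eq_le measure_ge0 andbT; apply/lee_addgt0Pr => r r0.
rewrite add0e.
have [U [EU dU sU]] := hausdorff_measure0_cover H0 e0 (divr_gt0 r0 C1).
have [V hV] := choice (fun n => H (U n) (dU n)).
apply: (@le_trans _ _ (\sum_(n <oo) mu (V n))).
  apply: measure_sigma_subadditive => //; first by move=> n; case: (hV n).
  move=> x Ax; have [n _ Ufx] : (\bigcup_n U n) (f x).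
    by apply: EU; apply: fA; exists x.
  by exists n => //; case: (hV n) => _ + _; apply.
apply: (@le_trans _ _ (\sum_(n <oo) ((C + 1)%:E * hausdorff_cost s (U n)))).
  apply: lee_nneseries => n _ //; case: (hV n) => _ _ /le_trans; apply.
  by apply: lee_wpmul2r; [exact: hausdorff_cost_ge0 | rewrite lee_fin lerDl].
rewrite nneseriesZl; last by move=> n _; exact: hausdorff_cost_ge0.
have := lee_wpmul2l (_ : 0 <= (C + 1)%:E) (ltW sU).
by rewrite lee_fin -EFinM mulrC divfK ?gt_eqF // => /(_ (ltW C1)).
Qed.

Lemma hausdorff_measure1_lebesgue E : measurable E ->
  hausdorff_measure 1 E = 0 -> lebesgue_measure E = 0.
Proof.
move=> mE H0; apply: (@mass_distribution _ _ (@lebesgue_measure R) id E E 1 1 2) => //.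
  by move=> _ [x Ex <-].
move=> U dU; have [->|/set0P U0] := eqVneq U set0.
  exists set0; split=> //.
  by rewrite measure0 mule_ge0 ?hausdorff_cost_ge0.
have [x Ux] := U0.
have dE : diam U = (fine (diam U))%:E.
  rewrite fineK // fin_numElt (lt_le_trans _ (diam_ge0 U0)) ?ltNyr //.
  by rewrite (le_lt_trans dU) ?ltry.
exists `[(x - fine (diam U))%R, (x + fine (diam U))%R]%classic; split=> //.
  move=> y [_ /= Uy]; rewrite in_itv /= -ler_distlC.
  by rewrite -lee_fin -dE diam_ge.
rewrite [leLHS](lebesgue_measure_itv
  `[(x - fine (diam U))%R, (x + fine (diam U))%R]) /= lte_fin; case: ifPn => [_|_]; last first.
  by rewrite mule_ge0 ?hausdorff_cost_ge0.
rewrite /hausdorff_cost; case: eqP => [E0|_]; first by case: U0 => z; rewrite E0.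
rewrite poweRe1 ?diam_ge0 // -EFinB dE -EFinM lee_fin /=.
lra.
Qed.

End hausdorff.

(** * The upper bound for the dimension *)

(** Split according to the first letter: the sum is at most 1 plus sigma times
    a convex combination of two sums of the same kind. *)
Lemma sum_uniq_words_le (R : realType) (p : bool -> R) (sigma : R) (L : seq (seq bool)) :
  (forall i, 0 <= p i) -> p false + p true = 1 -> 0 <= sigma < 1 -> uniq L ->
  \sum_(w <- L) sigma ^+ size w * word_prod p w <= (1 - sigma)^-1.
Proof.
move=> p0 p1 /andP[s0 s1].
pose F w := sigma ^+ size w * word_prod p w.
pose tl b (w : seq bool) : option (seq bool) :=
  if w is c :: v then if c == b then Some v else None else None.
have tlK b : ocancel (tl b) (cons b).
  by case=> [//|c v] /=; case: eqP => [->|].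
have split_sum K : \sum_(w <- K) F w = (count_mem [::] K)%:R +
    sigma * (p false * (\sum_(w <- pmap (tl false) K) F w) +
             p true * (\sum_(w <- pmap (tl true) K) F w)).
  elim: K => [|w K IH]; first by rewrite /= !big_nil; ring.
  rewrite big_cons IH; case: w => [|b w] /=.
    by rewrite {1}/F /= word_prod_nil mulr1 expr0 natrD addrA.
  rewrite {1}/F word_prod_cons /= exprS; case: b => /=; rewrite big_cons /F; ring.
have [N hN] : exists N, all (fun w => (size w < N)%N) L.
  elim: L => [|w L [N hN]]; first by exists 0%N.
  exists (maxn (size w).+1 N) => /=; rewrite leq_max leqnn /=.
  by apply: sub_all hN => v hv; rewrite leq_max hv orbT.
elim: N L hN => [|N IH] L hN uL.
  by case: L hN uL => // _ _; rewrite big_nil invr_ge0; lra.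
have bnd b : \sum_(w <- pmap (tl b) L) F w <= (1 - sigma)^-1.
  apply: IH; last exact: pmap_uniq (tlK b) _ uL.
  apply/allP => w; rewrite mem_pmap => /mapP[v vL] E.
  have := allP hN v vL; case: v E {vL} => //= c v; case: eqP => // _ [->].
  by rewrite ltnS.
rewrite split_sum.
have c1 : (count_mem [::] L)%:R <= 1 :> R.
  by rewrite (count_uniq_mem _ uL); case: (_ \in _); rewrite ?ler01.
have -> : (1 - sigma)^-1 = 1 +
    sigma * (p false * (1 - sigma)^-1 + p true * (1 - sigma)^-1).
  rewrite -mulrDl p1 mul1r; field; by rewrite gt_eqF // subr_gt0.
by apply: lerD => //; apply: ler_wpM2l => //; apply: lerD; apply: ler_wpM2l.
Qed.

Section dimension_bounds.
Variables (R : realType) (g0 p0 : R).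
Hypothesis hg0 : 2^-1 <= g0 < 1.
Hypothesis hp0 : 0 < p0 < 1.

(** The law of a digit equal to [false] with probability [p0]. *)
Definition digit_law (i : bool) : R := if i then 1 - p0 else p0.
Local Notation p := digit_law.

(** The entropy of the law of a digit. *)
Definition entropy : R := - (p0 * ln p0 + (1 - p0) * ln (1 - p0)).
(** The exponential rate at which the cylinders around a number with frequency
    [p0] of the digit 0 shrink. *)
Definition shrink_rate : R := - (p0 * ln g0 + (1 - p0) * ln (1 - g0)).

Lemma digit_law_gt0 i : 0 < p i. Proof. by case: i => /=; move: hp0; lra. Qed.
Lemma digit_law_sum : p false + p true = 1. Proof. by rewrite /=; ring. Qed.

Lemma shrink_rate_gt0 : 0 < shrink_rate.
Proof.
rewrite oppr_gt0 -[ltRHS](addr0 0); apply: ltrD.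
  by rewrite pmulr_rlt0 ?ln_lt0 //; move: hg0 hp0; lra.
by rewrite pmulr_rlt0 ?ln_lt0 //; move: hg0 hp0; lra.
Qed.

Lemma entropy_gt0 : 0 < entropy.
Proof.
rewrite oppr_gt0 -[ltRHS](addr0 0); apply: ltrD.
  by rewrite pmulr_rlt0 ?ln_lt0 //; move: hp0; lra.
by rewrite pmulr_rlt0 ?ln_lt0 //; move: hp0; lra.
Qed.

(** The comparison of the size and of the probability of the cylinders along a
    sequence with the right digit frequencies. *)
Lemma cvg_cylinder_exponent s alpha : has_frequency alpha p0 ->
  (s * ln (word_prod (G2_ratio g0) (mkseq alpha n)) -
     ln (word_prod p (mkseq alpha n))) / n%:R @[n --> \oo] -->
  entropy - s * shrink_rate.
Proof.
move=> hf.
have -> : entropy - s * shrink_rate =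
    s * (p0 * ln (G2_ratio g0 false) + (1 - p0) * ln (G2_ratio g0 true)) -
    (p0 * ln (p false) + (1 - p0) * ln (p true)).
  by rewrite /entropy /shrink_rate /=; ring.
under eq_fun do rewrite mulrBl -mulrA.
apply: cvgB; last by apply: cvg_ln_word_prod => // i; exact: digit_law_gt0.
apply: cvgM; first exact: cvg_cst.
by apply: cvg_ln_word_prod => // i; exact: G2_ratio_gt0.
Qed.

(** The cylinders of the long words of small size compared with their
    probability cover the set, and their total cost is the tail of a geometric
    series. *)
Lemma hausdorff_measure_upper s : entropy / shrink_rate < s ->
  hausdorff_measure s (besicovitch_eggleston g0 p0) = 0%E.
Proof.
rewrite ltr_pdivrMr ?shrink_rate_gt0 // => hs.
have s0 : 0 < s by have := entropy_gt0; have := shrink_rate_gt0; nra.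
have u_gt0 w : 0 < word_prod (G2_ratio g0) w.
  by apply: word_prod_gt0 => i; exact: G2_ratio_gt0.
have P_gt0 w : 0 < word_prod p w.
  by apply: word_prod_gt0 => i; exact: digit_law_gt0.
(* The exponent of the cylinders around a number of the set tends to
   [- 3 * kappa], hence ends up below [- 2 * kappa]; one [kappa] makes the
   series converge and the other one makes its tail small. *)
pose kappa := (s * shrink_rate - entropy) / 3.
have kappa0 : 0 < kappa by rewrite /kappa; lra.
pose sigma := expR (- kappa).
have sigma1 : 0 <= sigma < 1.
  by rewrite expR_ge0 -[ltRHS]expR0 ltr_expR oppr_lt0.
pose good w : Prop := s * ln (word_prod (G2_ratio g0) w) <=
  ln (word_prod p w) - 2 * kappa * (size w)%:R.
have good_le w M : good w -> (M <= size w)%N ->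
    (word_prod (G2_ratio g0) w * g0) `^ s <=
      sigma ^+ M * (sigma ^+ size w * word_prod p w).
  move=> gw Mw.
  apply: (@le_trans _ _ (word_prod (G2_ratio g0) w `^ s)).
    apply: ge0_ler_powR; rewrite ?nnegrE ?mulr_ge0 ?(ltW (u_gt0 _)) ?(ltW s0) //.
      by move: hg0; lra.
    by rewrite ler_piMr ?(ltW (u_gt0 _)) //; move: hg0; lra.
  rewrite /powR gt_eqF ?u_gt0 //.
  apply: (@le_trans _ _ (sigma ^+ size w * (sigma ^+ size w * word_prod p w))).
    rewrite -[word_prod p w in leRHS]lnK ?posrE ?P_gt0 // -expRM_natl -!expRD ler_expR.
    by move: gw; rewrite /good -mulr_natl; lra.
  rewrite ler_wpM2r ?mulr_ge0 ?exprn_ge0 ?(ltW (P_gt0 _)) ?expR_ge0 //.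
  by apply: ler_wiXn2l => //; [exact: expR_ge0 | case/andP: sigma1 => _ /ltW].
apply: hausdorff_measure_eq0 => e r e0 r0.
have sigma_inv : 0 < 1 - sigma by rewrite subr_gt0; case/andP: sigma1.
have small (x t : R) : 0 <= x < 1 -> 0 < t -> \forall n \near \oo, x ^+ n <= t.
  move=> /andP[x0 x1] t0.
  have /cvgrPdist_lt /(_ t t0) : x ^+ n @[n --> \oo] --> 0.
    by apply: cvg_expr; rewrite ger0_norm.
  apply: filterS => n; rewrite sub0r normrN ger0_norm ?exprn_ge0 //.
  exact: ltW.
have [M [M1 M2]] : exists M, sigma ^+ M <= r * (1 - sigma) /\ g0 ^+ M <= e.
  have g01 : 0 <= g0 < 1 by move: hg0; lra.
  have [N1 _ h1] := small _ _ sigma1 (mulr_gt0 r0 sigma_inv).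
  have [N2 _ h2] := small _ _ g01 e0.
  by exists (maxn N1 N2); split; [apply: h1|apply: h2] => /=; rewrite leq_max leqnn ?orbT.
pose U k := if pickle_inv k is Some w then
  if (M <= size w)%N && `[< good w >] then G2_cylinder g0 w else set0 else set0.
have diam_cyl w : (diam (G2_cylinder g0 w) <= (word_prod (G2_ratio g0) w * g0)%:E)%E.
  by apply: diam_le => x y; exact: dist_cylinder_le.
have diam0 : (diam (@set0 R) <= 0%:E)%E by apply: diam_le.
have cyl_ge0 w : 0 <= word_prod (G2_ratio g0) w * g0.
  by rewrite mulr_ge0 ?(ltW (u_gt0 _)) //; move: hg0; lra.
exists U; split.
- move=> x [hx [alpha xE hf]].
  have /cvgrPdist_lt /(_ _ kappa0) [N _ hN] := cvg_cylinder_exponent (s := s) hf.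
  pose n := maxn N.+1 M; pose w := mkseq alpha n.
  exists (pickle w) => //; rewrite /U pickleK_inv size_mkseq leq_maxr /=.
  case: asboolP => [_|[]]; first by rewrite xE; exact: G2_value_cylinder.
  have n0 : 0 < n%:R :> R by rewrite ltr0n leq_max.
  have := hN n (leq_trans (leqnSn N) (leq_maxl _ _)).
  rewrite distrC ltr_norml => /andP[_]; rewrite ltrBlDr ltr_pdivrMr //.
  have -> : kappa + (entropy - s * shrink_rate) = - 2 * kappa by rewrite /kappa; field.
  by rewrite /good size_mkseq; lra.
- move=> k; rewrite /U; case: pickle_inv => [w|]; last first.
    by apply: le_trans diam0 _; rewrite lee_fin ltW.
  case: ifP => [/andP[Mw _]|_]; last by apply: le_trans diam0 _; rewrite lee_fin ltW.
  apply: (le_trans (diam_cyl w)); rewrite lee_fin (le_trans _ M2) //.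
  apply: (@le_trans _ _ (g0 ^+ size w)).
    apply: le_trans (word_prod_ratio_le hg0 w).
    by rewrite ler_piMr ?(ltW (u_gt0 _)) //; move: hg0; lra.
  by apply: ler_wiXn2l => //; move: hg0; lra.
- apply: lime_le.
    by apply: is_cvg_nneseries => k _ _; exact: hausdorff_cost_ge0.
  apply: nearW => K.
  apply: (@le_trans _ _ (\sum_(w <- pmap (@pickle_inv (seq bool)) (iota 0 K))
      (sigma ^+ M * (sigma ^+ size w * word_prod p w)))%:E); last first.
    rewrite lee_fin -mulr_sumr.
    apply: (@le_trans _ _ (sigma ^+ M * (1 - sigma)^-1)); last by rewrite ler_pdivrMr.
    apply: ler_wpM2l; first by rewrite exprn_ge0 ?expR_ge0.
    apply: sum_uniq_words_le => //; [by move=> i; exact/ltW/digit_law_gt0|exact: digit_law_sum|].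
    by apply: pmap_uniq (@pickle_invK _) _ (iota_uniq _ _).
  have F0 w : 0 <= sigma ^+ M * (sigma ^+ size w * word_prod p w).
    by rewrite !mulr_ge0 ?exprn_ge0 ?expR_ge0 // ltW.
  have cost0 : hausdorff_cost s (@set0 R) = 0%E by rewrite /hausdorff_cost eqxx.
  rewrite /index_iota subn0; elim: (iota 0 K) => [|k l IH]; first by rewrite !big_nil.
  rewrite big_cons /= /U; case E: (pickle_inv k) => [w|] /=; last by rewrite cost0 add0e.
  rewrite big_cons EFinD; apply: leeD => //.
  case: ifP => [/andP[Mw /asboolP gw]|_]; last by rewrite cost0 lee_fin.
  apply: (le_trans (hausdorff_cost_le (ltW s0) (cyl_ge0 w) (diam_cyl w))).
  by rewrite lee_fin good_le.
Qed.

End dimension_bounds.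

(** * The distribution and the lower bound for the dimension *)

Section distribution.
Variables (R : realType) (g0 : R).
Hypothesis hg0 : 2^-1 <= g0 < 1.
Variables (d : measure_display) (Omega : measurableType d) (P : probability Omega R).
Variables (xi : nat -> {RV P >-> bool}) (hatxi : {RV P >-> R}) (p0 : R).
Hypothesis hp0 : 0 < p0 < 1.
Hypothesis hindep : mutually_independent xi.
Hypothesis hdist : forall n i, P [set w | xi n w = i] = (digit_law p0 i)%:E.
Hypothesis hhatxi : forall w, hatxi w = G2_value g0 (digits xi w).
Hypothesis hcont : no_atoms (distribution P hatxi).

Local Notation p := (digit_law p0).
Local Notation B := (besicovitch_eggleston g0 p0).
Local Notation D := (G2_binary g0).

Let measurable_hatxi (A : set R) : measurable A -> measurable (hatxi @^-1` A).
Proof. by move=> mA; rewrite -[X in measurable X]setTI; apply: measurable_funPT. Qed.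

Let measurable_binary : measurable D.
Proof. by apply: countable_measurable => //; exact: countable_G2_binary. Qed.

Let measurable_B : measurable B. Proof. exact: measurable_besicovitch_eggleston. Qed.

Lemma negligible_binary : P.-negligible (hatxi @^-1` D).
Proof.
pose F k := if pickle_inv k is Some w then
  hatxi @^-1` [set G2_word g0 w (g0 ^+ 2)] else set0.
apply: (@negligibleS _ _ _ _ (\bigcup_k F k)).
  by move=> o [w _ E]; exists (pickle w) => //; rewrite /F pickleK_inv /= E.
apply: negligible_bigcup => k; rewrite /F; case: pickle_inv => [w|]; last first.
  exact: negligible_set0.
by apply/negligibleP; [exact: measurable_hatxi | exact: hcont].
Qed.

Lemma negligible_not_besicovitch_eggleston : P.-negligible (hatxi @^-1` (~` B)).
Proof.
apply: negligibleS (strong_law_digits hindep _ hdist); last by rewrite digit_law_sum.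
move=> o /= nB hf; apply: nB; split; first by rewrite hhatxi; exact: G2_value_itv.
by exists (digits xi o).
Qed.

Lemma essential_support_besicovitch_eggleston :
  essential_support (distribution P hatxi) B.
Proof.
split=> //; have mB := measurable_hatxi measurable_B.
have := probability_setC P mB.
have -> : P (~` (hatxi @^-1` B)) = 0%E.
  by apply: measure_negligible;
    [exact: measurableC | exact: negligible_not_besicovitch_eggleston].
move=> H; suff : P (hatxi @^-1` B) = 1%E by [].
move: H; rewrite -[P (hatxi @^-1` B)]fineK ?fin_num_measure // -EFinB.
by move=> [] /eqP; rewrite eq_sym subr_eq0 => /eqP <-.
Qed.

(** The mass distribution principle applies to the outcomes for which all long
    prefixes span a cylinder of probability at most the power [s] of its size;
    by the convergence of the exponents almost all outcomes are of this
    kind. *)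
Lemma hausdorff_measure_lower s : 0 <= s -> s < entropy p0 / shrink_rate g0 p0 ->
  hausdorff_measure s B <> 0%E.
Proof.
move=> s0; rewrite ltr_pdivlMr ?shrink_rate_gt0 // => hs H0.
have u_gt0 w : 0 < word_prod (G2_ratio g0) w.
  by apply: word_prod_gt0 => i; exact: G2_ratio_gt0.
have P_gt0 w : 0 < word_prod p w.
  by apply: word_prod_gt0 => i; exact: digit_law_gt0.
pose good w := ln (word_prod p w) <= s * ln (word_prod (G2_ratio g0) w).
pose A N := hatxi @^-1` (B `\` D) `&`
  \bigcap_(n in [set n | (N <= n)%N]) [set o | good (mkseq (digits xi o) n)].
have mA N : measurable (A N).
  apply: measurableI; first by apply: measurable_hatxi; exact: measurableD.
  apply: bigcap_measurableType => n _; exact: measurable_prefix_pred.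
pose c := (1 - g0) * g0 ^+ 2.
have c0 : 0 < c by rewrite mulr_gt0 ?exprn_gt0 //; move: hg0; lra.
have g1 : 0 < 1 - g0 by move: hg0; lra.
have PA N : P (A N) = 0%E.
  (* A cylinder of a word shorter than [N] is too long to come from a set of
     diameter at most [e]. *)
  pose e := c * (1 - g0) ^+ N / 4.
  have e0 : 0 < e by rewrite divr_gt0 // mulr_gt0 ?exprn_gt0.
  have hC : 0 <= 2 * (2 / c) `^ s :> R by rewrite mulr_ge0 ?powR_ge0.
  apply: (mass_distribution (f := hatxi) (s := s) e0 hC (mA N) _ H0).
    by move=> _ [ o [[Bo _] _] <-].
  move=> U dU.
  have [hU|noU] := pselect (exists u, [/\ U u, 0 <= u & u <= g0]); last first.
    exists set0; split=> //; last by rewrite measure0 mule_ge0 ?hausdorff_cost_ge0.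
    move=> o [_ /= Uo]; apply: noU; exists (hatxi o); split=> //; rewrite hhatxi;
    by case/andP: (G2_value_itv hg0 (digits xi o)).
  have [u [Uu u0 ug]] := hU.
  have U0 : U !=set0 by exists u.
  pose r := fine (diam U).
  have dE : diam U = r%:E.
    rewrite fineK // fin_numElt (lt_le_trans _ (diam_ge0 U0)) ?ltNyr //.
    by rewrite (le_lt_trans dU) ?ltry.
  have r0 : 0 <= r by rewrite -lee_fin -dE diam_ge0.
  have re : r <= e by rewrite -lee_fin -dE.
  have dist_u x : U x -> `|x - u| <= r by move=> Ux; rewrite -lee_fin -dE diam_ge.
  have costE : hausdorff_cost s U = (r `^ s)%:E.
    by rewrite /hausdorff_cost dE; case: eqP => // E; move: Uu; rewrite E.
  (* A set of diameter 0 may cost nothing, but it has no mass either, since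
     there are no atoms. *)
  have [r_eq0|r_neq0] := eqVneq r 0.
    exists (hatxi @^-1` [set u]); split.
    - exact: measurable_hatxi.
    - by move=> o [_ /= /dist_u]; rewrite r_eq0 normr_le0 subr_eq0 => /eqP.
    - by rewrite [leLHS]hcont mule_ge0 ?hausdorff_cost_ge0.
  have r_gt0 : 0 < r by rewrite lt_def r_neq0.
  pose a := Num.max 0 (u - r); pose b := Num.min g0 (u + r).
  have a0 : 0 <= a by rewrite le_max lexx.
  have bg : b <= g0 by rewrite ge_min lexx.
  have ab : a < b.
    by rewrite lt_min !gt_max; move: hg0; lra.
  have ba : b - a <= 2 * r.
    have h1 : b <= u + r by rewrite ge_min lexx orbT.
    have h2 : u - r <= a by rewrite le_max lexx orbT.
    lra.
  have [v [w [hv hw hvw]]] := two_cylinders hg0 a0 ab bg.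
  (* For the outcomes in [A N] only these words can be prefixes. *)
  pose V x := if (N <= size x)%N && good x then prefix_event xi x else set0.
  have mV x : measurable (V x).
    by rewrite /V; case: ifP => // _; exact: measurable_prefix_event.
  have PV x : word_prod (G2_ratio g0) x <= (b - a) / c ->
      (P (V x) <= ((2 / c) `^ s * r `^ s)%:E)%E.
    move=> hx; rewrite /V; case: ifP => [/andP[_ gx]|_]; last first.
      by rewrite measure0 lee_fin mulr_ge0 ?powR_ge0.
    rewrite [leLHS](prefix_event_prob hindep hdist) lee_fin.
    rewrite -powRM ?divr_ge0 ?(ltW c0) //.
    apply: (@le_trans _ _ (word_prod (G2_ratio g0) x `^ s)).
      by rewrite /powR gt_eqF ?u_gt0 // -[leLHS]lnK ?posrE // ler_expR.
    apply: ge0_ler_powR; rewrite ?nnegrE ?mulr_ge0 ?invr_ge0 ?(ltW (u_gt0 _)) ?(ltW c0) //.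
    by apply: (le_trans hx); rewrite mulrAC ler_pM2r ?invr_gt0.
  have AV x o : word_prod (G2_ratio g0) x <= (b - a) / c -> A N o ->
      G2_cylinder g0 x (hatxi o) -> V x o.
    move=> hx [[_ nD] hgood] Ix; rewrite hhatxi in Ix.
    have px : mkseq (digits xi o) (size x) = x.
      by apply: cylinder_prefix Ix _ => //; rewrite -hhatxi.
    have Nx : (N <= size x)%N.
      rewrite leqNgt; apply/negP => xN.
      have h1 : (1 - g0) ^+ N <= word_prod (G2_ratio g0) x.
        apply: le_trans (word_prod_ratio_ge hg0 x).
        by apply: ler_wiXn2l; [exact: ltW | move: hg0; lra | exact: ltnW].
      have h2 : (1 - g0) ^+ N * c <= 2 * e.
        rewrite -ler_pdivlMr // (le_trans h1) // (le_trans hx) //.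
        by rewrite ler_pM2r ?invr_gt0 //; lra.
      have h3 : 0 < (1 - g0) ^+ N * c by rewrite mulr_gt0 ?exprn_gt0.
      have h4 : 4 * e = (1 - g0) ^+ N * c by rewrite /e mulrC divfK // mulrC.
      by move: h2 h3; rewrite -h4; lra.
    by rewrite /V Nx -px; have := hgood _ Nx; rewrite /= px => ->.
  exists (V v `|` V w); split; first exact: measurableU.
    move=> o [Ao /= Uo]; have /andP[x0 xg] := G2_value_itv hg0 (digits xi o).
    rewrite -hhatxi in x0 xg; have := dist_u _ Uo; rewrite ler_norml => /andP[h1 h2].
    have [|h|h] := hvw (hatxi o).
    - by rewrite ge_max le_min x0 xg /=; apply/andP; split; lra.
    - by left; exact: AV.
    - by right; exact: AV.
  have -> : ((2 * (2 / c) `^ s)%:E * hausdorff_cost s U =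
      ((2 / c) `^ s * r `^ s)%:E + ((2 / c) `^ s * r `^ s)%:E)%E.
    by rewrite costE -EFinM -EFinD; congr EFin; ring.
  by apply: le_trans (measureU2 _ _ _) _ => //; apply: leeD; exact: PV.
have : P.-negligible [set: Omega].
  apply: (@negligibleS _ _ _ _ ((hatxi @^-1` D `|` hatxi @^-1` (~` B)) `|`
     (~` [set o | has_frequency (digits xi o) p0] `|` \bigcup_N A N))); last first.
    apply: negligibleU.
      exact: negligibleU negligible_binary negligible_not_besicovitch_eggleston.
    apply: negligibleU.
      by apply: (strong_law_digits hindep _ hdist); rewrite digit_law_sum.
    by apply: negligible_bigcup => N; apply/negligibleP; [exact: mA | exact: PA].
  move=> o _.
  have [Do|nD] := pselect (D (hatxi o)); first by left; left.
  have [Bo|nB] := pselect (B (hatxi o)); last by left; right.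
  have [hf|nf] := pselect (has_frequency (digits xi o) p0); last by right; left.
  right; right.
  have h0 : 0 < entropy p0 - s * shrink_rate g0 p0 by lra.
  have /cvgrPdist_lt /(_ _ h0) [N _ hN] := cvg_cylinder_exponent hg0 hp0 (s := s) hf.
  exists N.+1 => //; split=> // n /= Nn.
  have n0 : 0 < n%:R :> R by rewrite ltr0n (leq_trans _ Nn).
  have := hN n (ltnW Nn); rewrite ltr_norml => /andP[_].
  rewrite ltrBlDr ltrDl pmulr_lgt0 ?invr_gt0 // subr_gt0 => /ltW.
  exact.
move=> /(measure_negligible measurableT) h1.
by have := @probability_setT _ _ _ P; rewrite h1 => /eqP; rewrite eq_sym onee_eq0.
Qed.

Lemma hausdorff_dim_besicovitch_eggleston :
  hausdorff_dim B = (entropy p0 / shrink_rate g0 p0)%:E.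
Proof.
apply: hausdorff_dim_eq.
- by rewrite divr_ge0 ?(ltW (entropy_gt0 _)) ?(ltW (shrink_rate_gt0 _ _)).
- by move=> s; exact: hausdorff_measure_upper.
- by move=> s /andP[]; exact: hausdorff_measure_lower.
Qed.

End distribution.

(** * Self-similarity and singularity *)

Section self_similarity.
Variables (R : realType) (g0 p0 : R).
Hypothesis hg0 : 2^-1 <= g0 < 1.
Local Notation B := (besicovitch_eggleston g0 p0).

Lemma besicovitch_eggleston_branch i y : B y -> B (G2_branch g0 i y).
Proof.
move=> [hy [alpha yE hf]]; split; first exact: G2_branch_itv.
pose beta n := if n is m.+1 then alpha m else i.
exists beta; first by rewrite G2_value_cons // yE.
by apply/(has_frequency_shift beta).
Qed.

Lemma besicovitch_eggleston_unbranch x : B x ->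
  exists i y, B y /\ x = G2_branch g0 i y.
Proof.
move=> [hx [alpha xE hf]]; exists (alpha 0%N), (G2_value g0 (fun k => alpha k.+1)).
split; last by rewrite xE G2_value_cons.
split; first exact: G2_value_itv.
by exists (fun k => alpha k.+1) => //; apply/(has_frequency_shift alpha).
Qed.

(** The copies are the images under the two branches, which meet in at most one
    point. *)
Lemma scale_invariant_besicovitch_eggleston : B !=set0 ->
  (0 < hausdorff_dim B)%E -> scale_invariant B.
Proof.
move=> B0 dim0; split=> //.
  exists g0; split; first exact: num_real.
  move=> M gM x [/andP[x0 xg] _] /=; rewrite ger0_norm //.
  exact: le_trans xg (ltW gM).
pose dg (i : 'I_2) : bool := i != ord0.
exists 2%N, (fun i => G2_g g0 (dg i)), (fun i => G2_delta g0 (dg i)) => copy.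
have copyP i x : copy i x <-> exists2 y, B y & G2_branch g0 (dg i) y = x.
  by rewrite /copy /G2_branch; split=> -[y By <-]; exists y => //; rewrite addrC.
split=> //.
- move=> i; rewrite normr_G2_g // G2_ratio_gt0 //=.
  by rewrite (le_lt_trans (G2_ratio_le _ _)) //; case/andP: hg0.
- apply/seteqP; split=> x.
    move=> /besicovitch_eggleston_unbranch[b [y [By ->]]].
    exists (if b then ord_max else ord0) => //; apply/copyP.
    by exists y => //; case: (b).
  by move=> [i _ /copyP[y By <-]]; exact: besicovitch_eggleston_branch.
- move=> i j ij.
  have sub : copy i `&` copy j `<=` [set g0 ^+ 2].
    move=> x [/copyP[y [hy _] yE] /copyP[z [hz _] zE]] /=.
    have : dg i != dg j.
      by case: i j ij {yE zE} => [[|[|//]] ?] [[|[|//]] ?].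
    rewrite -yE; move: zE; rewrite -yE; case: (dg i); case: (dg j) => // E _.
      by rewrite -E (G2_branch_meet hg0 hz hy).
    by rewrite (G2_branch_meet hg0 hy hz).
  have [s [s0 sB]] : exists s : R, 0 < s /\ (s%:E < hausdorff_dim B)%E.
    case: (hausdorff_dim B) dim0 => [r|_|//].
      by rewrite lte_fin => r0; exists (r / 2); rewrite lte_fin; lra.
    by exists 1; rewrite ltry.
  apply: le_lt_trans sB; apply: hausdorff_dim_le; first exact: ltW.
  exact: hausdorff_measure_subset1 sub.
Qed.

End self_similarity.

(** Gibbs' inequality. *)
Lemma entropy_lt_shrink_rate (R : realType) (g0 p0 : R) :
  2^-1 <= g0 < 1 -> 0 < p0 < 1 -> p0 <> g0 -> entropy p0 < shrink_rate g0 p0.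
Proof.
move=> hg0 hp0 pg.
have H (x y : R) : 0 < x -> 0 < y -> x <> y -> x * (ln y - ln x) < y - x.
  move=> x0 y0 xy; rewrite -ln_div ?posrE //.
  have q0 : 0 < y / x by rewrite divr_gt0.
  have : ln (y / x) != 0.
    rewrite ln_eq0 //; apply: contra_not_neq xy => /(congr1 ( *%R^~ x)).
    by rewrite divfK ?gt_eqF // mul1r.
  move=> /expR_gt1Dx; rewrite lnK ?posrE // ltr_pdivlMr // mulrC mulrDr; lra.
have h1 := H p0 g0; have h2 := H (1 - p0) (1 - g0).
rewrite /entropy /shrink_rate.
have {}h1 : p0 * (ln g0 - ln p0) < g0 - p0 by apply: h1 => //; move: hg0 hp0; lra.
have {}h2 : (1 - p0) * (ln (1 - g0) - ln (1 - p0)) < (1 - g0) - (1 - p0).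
  by apply: h2; [move: hp0; lra | move: hg0; lra | move=> E; apply: pg; lra].
by rewrite ltrN2; lra.
Qed.

(** A digit of probability zero almost surely never occurs, so that the
    distribution has an atom at the number with constant digits. *)
Lemma digit_prob_neq0 (R : realType) (g0 : R) d (Omega : measurableType d)
    (P : probability Omega R) (xi : nat -> {RV P >-> bool}) (hatxi : {RV P >-> R}) i :
  (forall w, hatxi w = G2_value g0 (digits xi w)) ->
  no_atoms (distribution P hatxi) ->
  ~ (forall n, P [set w | xi n w = i] = 0%E).
Proof.
move=> hhatxi hcont h0.
have mxi n : measurable [set w | xi n w = i].
  rewrite -[X in measurable X]setTI -[[set w | xi n w = i]]/(xi n @^-1` [set i]).
  exact: measurable_funPT.
pose v := G2_value g0 (fun=> ~~ i).
have : P.-negligible [set: Omega].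
  apply: (@negligibleS _ _ _ _
      (\bigcup_n [set w | xi n w = i] `|` hatxi @^-1` [set v])); last first.
    apply: negligibleU.
      by apply: negligible_bigcup => n; apply/negligibleP; [exact: mxi | exact: h0].
    apply/negligibleP; last exact: hcont.
    by rewrite -[X in measurable X]setTI; exact: measurable_funPT.
  move=> o _; have [[n hn]|hno] := pselect (exists n, xi n o = i).
    by left; exists n.
  right; rewrite /= hhatxi /v; congr (G2_value g0); apply/funext => n.
  have : xi n o <> i by move=> E; apply: hno; exists n.
  by rewrite /digits; case: (xi n o); case: (i).
move=> /(measure_negligible measurableT) h1.
by have := @probability_setT _ _ _ P; rewrite h1 => /eqP; rewrite eq_sym onee_eq0.
Qed.

Theorem theorem18 (R : realType) (g0 : R) (hg0 : 2^-1 <= g0 < 1)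
    (d : measure_display) (Omega : measurableType d) (P : probability Omega R)
    (xi : nat -> {RV P >-> bool}) (p0 p1 : R)
    (hindep : mutually_independent xi)
    (hp : p0 + p1 = 1)
    (hdist0 : forall n : nat, P [set w | xi n w = false] = p0%:E)
    (hdist1 : forall n : nat, P [set w | xi n w = true] = p1%:E)
    (hatxi : {RV P >-> R})
    (hhatxi : forall w : Omega, hatxi w = G2_value g0 (fun n : nat => xi n w))
    (hcont : no_atoms (distribution P hatxi)) :
  [/\ p0 <> g0 -> singularly_continuous (distribution P hatxi),
      essential_support (distribution P hatxi) (besicovitch_eggleston g0 p0),
      fractal (besicovitch_eggleston g0 p0) &
      hausdorff_dim (besicovitch_eggleston g0 p0) =
        (ln (p0 `^ p0 * p1 `^ p1) / ln (g0 `^ p0 * (- (g0 - 1)) `^ p1))%:E].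
Proof.
have p1E : p1 = 1 - p0 by rewrite -hp addrAC subrr add0r.
have hdist n i : P [set w | xi n w = i] = (digit_law p0 i)%:E.
  by case: i; rewrite /= ?hdist0 // hdist1 p1E.
have law_gt0 i : 0 < digit_law p0 i.
  rewrite lt_def (digit_prob_ge0 hdist) andbT; apply/eqP => E.
  by apply: (digit_prob_neq0 hhatxi hcont (i := i)) => n; rewrite hdist E.
have hp0 : 0 < p0 < 1 by have := law_gt0 true; rewrite subr_gt0 (law_gt0 false).
have supp := essential_support_besicovitch_eggleston hg0 hindep hdist hhatxi.
have dimE := hausdorff_dim_besicovitch_eggleston hg0 hp0 hindep hdist hhatxi hcont.
have rate0 := shrink_rate_gt0 hg0 hp0.
have ratio0 : 0 < entropy p0 / shrink_rate g0 p0 by rewrite divr_gt0 ?entropy_gt0.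
split=> //.
- move=> pg; split=> //; case: supp => mB muB.
  exists (besicovitch_eggleston g0 p0); split=> //.
  apply: hausdorff_measure1_lebesgue => //.
  apply: hausdorff_measure_upper => //.
  by rewrite ltr_pdivrMr // mul1r entropy_lt_shrink_rate.
- constructor 1; apply: scale_invariant_besicovitch_eggleston => //.
    apply/set0P/eqP => B0; case: supp => _; rewrite B0 measure0 => /eqP.
    by rewrite eq_sym onee_eq0.
  by rewrite dimE lte_fin.
- rewrite dimE; congr EFin; rewrite p1E opprB.
  rewrite !lnM ?posrE ?powR_gt0 //; try by move: hg0 hp0; lra.
  by rewrite !ln_powR /entropy /shrink_rate invrN mulrNN.
Qed.
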